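(* Let $\mathfrak{s}=(s_1,\dots,s_r)\in\mathbb{N}^r$ and $\mathbf{u}\in\overline{k}^r$ with $\tilde{\mathbf{u}}\in\mathbb{D}^{\mathrm{Def}}_{\tilde{\mathfrak{s}},\overline{k}}$. Let $\mathbf{v}\in G_{\mathfrak{s},\mathbf{u}}(\overline{k}\cap\mathcal{O}_{\mathbb{C}_v})$ be such that $\log_{G_{\mathfrak{s},\mathbf{u}}}(\mathbf{v})$ converges $\infty$-adically. Pick $\ell\in\mathbb{N}$ with $\mathbf{v}\in G_{\mathfrak{s},\mathbf{u}}(A_{(v),\ell})$ and put $a(t)=(v(t)^{d_1\ell}-1)\cdots(v(t)^{d_r\ell}-1)$. For $n\ge0$ set $Z_n=\partial[v(t)^n]^{-1}\log_{G_{\mathfrak{s},\mathbf{u}}}(\mathbf{v})\in\mathbb{C}_\infty^d$ and $\mathbf{v}_n=\exp_{G_{\mathfrak{s},\mathbf{u}}}(Z_n)\in\mathbb{C}_\infty^d$. Then: (1) $[v(t)^n]\mathbf{v}_n=\mathbf{v}$ and $\mathbf{v}_n\in G_{\mathfrak{s},\mathbf{u}}(\overline{k})$; (2) if $n$ is divisible by $\mathrm{lcm}(d_1,\dots,d_r)$, then $\|[a(t)]\mathbf{v}_n\|_v<1$, and in particular $\log_{G_{\mathfrak{s},\mathbf{u}}}([a(t)]\mathbf{v}_n)_v$ converges $v$-adically; (3) $\lim_{n\to\infty}\|Z_n\|_\infty=0$; in particular $\log_{G_{\mathfrak{s},\mathbf{u}}}([a(t)]\mathbf{v}_n)$, $\partial[a(t)]\log_{G_{\mathfrak{s},\mathbf{u}}}(\mathbf{v}_n)$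 and $Z_n$ converge $\infty$-adically, and they lie in $\mathcal{D}_{G_{\mathfrak{s},\mathbf{u}}}$ for all sufficiently large $n$.
   Context: Let $q$ be a power of a prime $p$, $A=\mathbb{F}_q[\theta]$, $k=\mathbb{F}_q(\theta)$, $|\theta|_\infty=q$, $\mathbb{C}_\infty$ the completion of an algebraic closure of $k_\infty=\mathbb{F}_q((1/\theta))$. Let $v\in A$ be monic irreducible, $q_v=q^{\deg_\theta v}$, $|v|_v=q_v^{-1}$, $\mathbb{C}_v$ the completion of an algebraic closure of $k_v$, $\mathcal{O}_{\mathbb{C}_v}=\{|x|_v\le1\}$ with maximal ideal $\mathfrak{m}_v$ and residue field $\overline{\mathbb{F}_{q_v}}$; $\overline{k}$ an algebraic closure of $k$ with fixed embeddings into $\mathbb{C}_\infty,\mathbb{C}_v$ over $k$. For $\ell\in\mathbb{N}$, $A_{(v),\ell}=\{x\in\overline{k}\cap\mathcal{O}_{\mathbb{C}_v}:\ x\bmod\mathfrak{m}_v\in\mathbb{F}_{q_v^\ell}\}$. $v(t)$ denotes $v$ with $\theta$ replaced by $t$. For a vector or matrix $M$, $\|M\|_w$ is the max of $|M_{ij}|_w$. For $\Lambda=(\lambda_1,\dots,\lambda_r)$, $\tilde\Lambda=(\lambda_r,\dots,\lambda_1)$. For $\mathfrak{n}=(n_1,\dots,n_r)\in\mathbb{N}^r$: $\mathbb{D}_{\mathfrak{n},\infty}=\{(z_i)\in\mathbb{C}_\infty^r: |z_1|_\infty<q^{n_1q/(q-1)}, |z_i|_\infty\le q^{n_iq/(q-1)}\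 (2\le i\le r)\}$, $\mathbb{D}^{\mathrm{Def}}_{\mathfrak{n},v}=\{(z_i)\in\mathbb{C}_v^r:|z_i|_v\le1\ \forall i\}$, and $\mathbb{D}^{\mathrm{Def}}_{\mathfrak{n},\overline{k}}=\mathbb{D}_{\mathfrak{n},\infty}\cap\overline{k}^r\cap\mathbb{D}^{\mathrm{Def}}_{\mathfrak{n},v}$. $t$-modules: $\mathrm{Mat}_d(R)[\tau]$ is the twisted polynomial ring with $\tau M=M^{(1)}\tau$ ($q$-th powers of entries), acting on $R^d$ by $q$-Frobenius; a $t$-module $G$ over $\overline{k}$ is an $\mathbb{F}_q$-linear ring homomorphism $[\cdot]:\mathbb{F}_q[t]\to\mathrm{Mat}_d(\overline{k})[\tau]$ with $\partial[t]-\theta I_d$ nilpotent, $\partial[a]$ the $\tau^0$-coefficient of $[a]$; $G(R)=R^d$ with this $\mathbb{F}_q[t]$-action. $\exp_G$ is the unique $\mathbb{F}_q$-linear power series with $\exp_G(\mathbf{z})\equiv\mathbf{z}$ mod degree $q$ and $\exp_G\circ\partial[a]=[a]\circ\exp_G$; it is entire on $\mathbb{C}_\infty^d$. $\log_G$ is its formal inverse, $\log_G(\cdot)_v$ its $v$-adic evaluation. $\mathcal{D}_G$ denotes a fixed neighbourhood of $0$ in $\mathbb{C}_\infty^d$ on which $\exp_G$ is an isometry. $G_{\mathfrak{s},\mathbf{u}}$ for $\mathfrak{s}=(s_1,\dots,s_r)$, $\mathbf{u}=(u_1,\dots,u_r)$: $d_m=s_m+\cdots+s_r$, $d=\sum_m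 d_m$; coordinates indexed by $(m,j)$, $1\le j\le d_m$, lexicographically; $[t]=\theta I_d+N+E\tau$ with $N$ block diagonal whose $d_m\times d_m$ blocks have $1$'s on the superdiagonal and $0$ elsewhere, and $E$ block upper triangular whose $(m,m')$ block ($m\le m'$) has a single nonzero entry at position $(d_m,1)$, equal to $1$ if $m=m'$ and to $(-1)^{m'-m}u_m\cdots u_{m'-1}$ if $m<m'$.
   Formalization: Membership of v in G(A_{(v),ℓ}) is read as also requiring G to be defined over A_{(v),ℓ}, i.e. u_1,…,u_{r−1} lie in A_{(v),ℓ}; otherwise (2) fails, e.g. r=2, s=(1,1), v=θ, ℓ=1, n=0, u_1 a constant outside F_q, point (0,0,1). *)

(* Defs.v *)
From HB Require Import structures.
From mathcomp Require Import all_boot all_order all_algebra all_field.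
From mathcomp Require pgroup abelian.
From mathcomp Require Import all_classical all_reals all_analysis.
Set Implicit Arguments.
Unset Strict Implicit.
Unset Printing Implicit Defensive.
Import Order.TTheory GRing.Theory Num.Theory.
Import numFieldNormedType.Exports.
Local Open Scope classical_set_scope.
Local Open Scope ring_scope.

(* Twisted polynomials over [K] for an endomorphism [phi]: the additive group is
   that of {poly K}, with 'X in the role of tau, and tau * c = phi c * tau. *)
Definition skewpoly (K : nzRingType) (phi : {rmorphism K -> K}) := {poly K}.

Section SkewPoly.
Context (K : nzRingType) (phi : {rmorphism K -> K}).
Local Notation S := (skewpoly phi).

HB.instance Definition _ := GRing.Zmodule.copy S {poly K}.

Definition skew_mul (f g : S) : S :=
  \poly_(n < (size f + size g)%N) \sum_(i < n.+1) f`_i * iter i phi g`_(n - i).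

Lemma iter_phi0 i : iter i phi 0 = 0.
Proof. by elim: i => //= i ->; rewrite rmorph0. Qed.
Lemma iter_phi1 i : iter i phi 1 = 1.
Proof. by elim: i => //= i ->; rewrite rmorph1. Qed.
Lemma iter_phiD i x y : iter i phi (x + y) = iter i phi x + iter i phi y.
Proof. by elim: i => //= i ->; rewrite rmorphD. Qed.
Lemma iter_phiM i x y : iter i phi (x * y) = iter i phi x * iter i phi y.
Proof. by elim: i => //= i ->; rewrite rmorphM. Qed.
Lemma iter_phi_sum i (I : Type) (r : seq I) (P : pred I) (E : I -> K) :
  iter i phi (\sum_(j <- r | P j) E j) = \sum_(j <- r | P j) iter i phi (E j).
Proof. exact: (big_morph _ (iter_phiD i) (iter_phi0 i)). Qed.

Lemma coef_skew_mul (f g : S) n :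
  (skew_mul f g)`_n = \sum_(i < n.+1) f`_i * iter i phi g`_(n - i).
Proof.
rewrite coef_poly; case: ltnP => // le_fg_n; rewrite big1 // => i _.
have [lt_fi|le_fi] := ltnP i (size f); last by rewrite nth_default ?mul0r.
by rewrite [g`_ _]nth_default ?iter_phi0 ?mulr0 // leq_subRL;
  rewrite ?(leq_trans (leq_add _ _) le_fg_n) ?(ltnW lt_fi) // -ltnS.
Qed.

Lemma skew_mulA : associative skew_mul.
Proof.
move=> f g h; apply/polyP => n; rewrite !coef_skew_mul.
pose E j i := f`_j * (iter j phi g`_(i - j) * iter i phi h`_(n - i)).
transitivity (\sum_(j < n.+1) \sum_(i < n.+1 | (j <= i)%N) E j i).
  apply: eq_bigr => j _; rewrite coef_skew_mul iter_phi_sum big_distrr /=.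
  rewrite -(big_mkord (fun i => (j <= i)%N) (E j)).
  have le_jn : (j <= n.+1)%N := ltnW (ltn_ord j).
  rewrite (big_cat_nat (leq0n j) le_jn) //= [X in _ = X + _]big_nat_cond.
  rewrite [X in _ = X + _]big_pred0 ?add0r; last first.
    by move=> i; case: (leqP j i) => // le_ji; rewrite andbF.
  transitivity (\sum_(0 + j <= i < n.+1 | (j <= i)%N) E j i) => //.
  rewrite big_addn subSn ?leq_ord // big_mkord.
  apply: eq_big => [k|k _]; first by rewrite leq_addl.
  by rewrite /E addnK [(k + j)%N]addnC subnDA iter_phiM iterD.
rewrite (exchange_big_dep predT) //=; apply: eq_bigr => i _.
rewrite (big_ord_narrow_leq (leq_ord i)) coef_skew_mul big_distrl /=.
by apply: eq_bigr => j _; rewrite /E mulrA.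
Qed.

Lemma skew_mul1 : left_id (1%:P : S) skew_mul.
Proof.
move=> f; apply/polyP => n; rewrite coef_skew_mul big_ord_recl /= coefC mul1r subn0.
by rewrite big1 ?addr0 // => i _; rewrite coefC mul0r.
Qed.

Lemma skew_mulr1 : right_id (1%:P : S) skew_mul.
Proof.
move=> f; apply/polyP => n; rewrite coef_skew_mul big_ord_recr /= subnn coefC.
rewrite iter_phi1 mulr1 big1 ?add0r // => i _.
by rewrite coefC subn_eq0 leqNgt ltn_ord iter_phi0 mulr0.
Qed.

Lemma skew_mulDl : left_distributive skew_mul +%R.
Proof.
move=> f g h; apply/polyP => n; rewrite coefD !coef_skew_mul -big_split /=.
by apply: eq_bigr => i _; rewrite coefD mulrDl.
Qed.

Lemma skew_mulDr : right_distributive skew_mul +%R.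
Proof.
move=> f g h; apply/polyP => n; rewrite coefD !coef_skew_mul -big_split /=.
by apply: eq_bigr => i _; rewrite coefD iter_phiD mulrDr.
Qed.

HB.instance Definition _ := GRing.Zmodule_isNzRing.Build S
  skew_mulA skew_mul1 skew_mulr1 skew_mulDl skew_mulDr (oner_neq0 {poly K}).

Definition skewC (c : K) : S := c%:P.
Definition tau : S := 'X.

Lemma tau_skewC c : tau * skewC c = skewC (phi c) * tau.
Proof.
apply/polyP => n; rewrite !coef_skew_mul.
case: n => [|n].
  by rewrite !big_ord1 !coefX !coefC /= mul0r mulr0.
rewrite 2!big_ord_recl [RHS]big_ord_recl /= !coefX !coefC !subn0 /= mul0r add0r mul1r.
rewrite subn1 /= !big1 ?addr0 => [|i _|i _]; rewrite ?coefX ?coefC ?mul0r //.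
by case: n => [|n]; rewrite ?coefC /= ?mulr1 ?rmorph0 ?mulr0.
Qed.

End SkewPoly.

Section Frobenius.
Context (F : finFieldType) (K : fieldType) (iota : {rmorphism {fraction {poly F}} -> K}).

Definition theta : K := iota (FracField.tofrac 'X).
Definition kconst (c : F) : K := iota (FracField.tofrac c%:P).
Definition frob (_ : {rmorphism {fraction {poly F}} -> K}) (x : K) : K := x ^+ #|F|.

Lemma pnat_card_pchar : [pchar K].-nat #|F|.
Proof.
have [p p_pr pF] := finPcharP F.
have pK : p \in [pchar K].
  by apply: (rmorph_pchar iota); apply: (rmorph_pchar (@FracField.tofrac {poly F})); rewrite pchar_poly.
have /abelian.abelem_pgroup := abelian.fin_ring_pchar_abelem pF.
by rewrite /pgroup.pgroup cardsT; apply: sub_in_pnat => q _ /eqP ->.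
Qed.

Lemma frob_zmod : zmod_morphism (frob iota).
Proof.
move=> x y; rewrite /frob exprDn_pchar ?pnat_card_pchar //; congr (_ + _).
by apply/eqP; rewrite -addr_eq0 addrC -exprDn_pchar ?pnat_card_pchar //
  subrr expr0n gtn_eqF // ltnW // finNzRing_gt1.
Qed.

Lemma frob_monoid : monoid_morphism (frob iota).
Proof. by split=> [|x y]; rewrite /frob ?expr1n ?exprMn. Qed.

HB.instance Definition _ := GRing.isZmodMorphism.Build K K (frob iota) frob_zmod.
HB.instance Definition _ := GRing.isMonoidMorphism.Build K K (frob iota) frob_monoid.

Lemma frob_kconst c : frob iota (kconst c) = kconst c.
Proof. by rewrite /frob /kconst -!rmorphXn /= expf_card. Qed.

End Frobenius.

Section TModule.
Context (F : finFieldType) (K : fieldType) (iota : {rmorphism {fraction {poly F}} -> K}).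
Local Notation S := (skewpoly (frob iota)).

Definition tcoef d (P : 'M[S]_d) (i : nat) : 'M[K]_d :=
  map_mx (fun f : S => (f : {poly K})`_i) P.

Definition dpart d (P : 'M[S]_d) : 'M[K]_d := tcoef P 0.

(* The action of twisted polynomials on L^d, for a field L over K, tau acting by x |-> x^q. *)
Definition tapp d (L : fieldType) (j : K -> L) (P : 'M[S]_d) (z : 'cV[L]_d) : 'cV[L]_d :=
  \col_a \sum_b \sum_(i < size (P a b : {poly K}))
     j (P a b : {poly K})`_i * z b 0 ^+ (#|F| ^ i).

Definition Fscal d (c : F) : 'M[S]_d := (skewC (frob iota) (kconst iota c))%:M.

Record tmodule (d : nat) := TModule {
  tact :> {rmorphism {poly F} -> 'M[S]_d};
  tact_linear : forall c a, tact (c *: a) = Fscal d c * tact a;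
  tact_nilpotent : exists n, (dpart (tact 'X) - (theta iota)%:M) ^+ n = 0 }.

Section PolyAct.
Context (d : nat) (T : 'M[S]_d).

Definition poly_act (a : {poly F}) : 'M[S]_d :=
  \sum_(i < size a) Fscal d a`_i * T ^+ i.

Lemma FscalD c c' : Fscal d (c + c') = Fscal d c + Fscal d c'.
Proof.
rewrite /Fscal -raddfD /=; congr (_%:M).
by rewrite /skewC /kconst !(rmorphD, polyCD).
Qed.

Lemma Fscal0 : Fscal d 0 = 0.
Proof. by apply: (addrI (Fscal d 0)); rewrite -FscalD !addr0. Qed.

Lemma Fscal1 : Fscal d 1 = 1.
Proof. by rewrite /Fscal /kconst !rmorph1. Qed.

Lemma FscalM c c' : Fscal d (c * c') = Fscal d c * Fscal d c'.
Proof.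
rewrite /Fscal -[RHS]scalar_mxM; congr (_%:M); apply/polyP => n.
rewrite coef_skew_mul !coefC /kconst !rmorphM big_ord_recl big1 /= ?addr0 => [|i _].
  by rewrite !coefC subn0; case: n => //=; rewrite mulr0.
by rewrite coefC mul0r.
Qed.

Lemma FscalC c (M : 'M[S]_d) : Fscal d c * M = M * Fscal d c.
Proof.
rewrite -[LHS]/(Fscal d c *m M) -[RHS]/(M *m Fscal d c) /Fscal mul_scalar_mx.
apply/matrixP => i j; rewrite !mxE (bigD1 j) //= big1 ?addr0 => [|k /negPf kj]; last first.
  by rewrite mxE kj mulr0.
rewrite mxE eqxx; apply/polyP => n; rewrite !coef_skew_mul.
rewrite big_ord_recl big_ord_recr /= big1 ?big1 => [|k _|k _].
- rewrite addr0 add0r subnn subn0 !coefC /= mulrC; congr (_ * _).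
  by elim: n => //= n <-; rewrite frob_kconst.
- by rewrite coefC subn_eq0 leqNgt ltn_ord iter_phi0 mulr0.
- by rewrite coefC mul0r.
Qed.

Lemma poly_act_widen n (a : {poly F}) : (size a <= n)%N ->
  poly_act a = \sum_(i < n) Fscal d a`_i * T ^+ i.
Proof.
move=> le_an; rewrite /poly_act (big_ord_widen n (fun i => Fscal d a`_i * T ^+ i)) //.
rewrite big_mkcond; apply: eq_bigr => i _; case: ltnP => // le_ai.
by rewrite nth_default // Fscal0 mul0r.
Qed.

Lemma poly_actD a b : poly_act (a + b) = poly_act a + poly_act b.
Proof.
have le_D := size_polyD a b.
rewrite (poly_act_widen le_D) (poly_act_widen (leq_maxl (size a) (size b))).
rewrite (poly_act_widen (leq_maxr (size a) (size b))) -big_split /=.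
by apply: eq_bigr => i _; rewrite coefD FscalD mulrDl.
Qed.

Lemma poly_actZ c a : poly_act (c *: a) = Fscal d c * poly_act a.
Proof.
rewrite (poly_act_widen (size_scale_leq c a)) big_distrr /=.
by apply: eq_bigr => i _; rewrite coefZ FscalM mulrA.
Qed.

Lemma poly_actX (a : {poly F}) : poly_act (a * 'X) = poly_act a * T.
Proof.
have le_a : (size (a * 'X)%R <= (size a).+1)%N.
  by rewrite (leq_trans (size_polyMleq _ _)) // size_polyX addn2.
rewrite (poly_act_widen le_a) big_ord_recl coefMX Fscal0 mul0r add0r big_distrl /=.
by apply: eq_bigr => i _; rewrite coefMX /= exprSr mulrA.
Qed.

Lemma poly_actC c : poly_act c%:P = Fscal d c.
Proof.
by rewrite (poly_act_widen (size_polyC_leq1 c)) big_ord1 coefC mulr1.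
Qed.

Lemma poly_actM a b : poly_act (a * b) = poly_act a * poly_act b.
Proof.
elim/poly_ind: a => [|a c IH].
  by rewrite mul0r -[poly_act 0]/(poly_act 0%:P) poly_actC Fscal0 mul0r.
rewrite mulrDl poly_actD -mulrA ['X * b]mulrC mulrA poly_actX IH -mulrA.
have TC e : poly_act e * T = T * poly_act e.
  rewrite big_distrl big_distrr /=; apply: eq_bigr => i _.
  by rewrite -mulrA -exprSr exprS !mulrA FscalC.
by rewrite TC mulrA -poly_actX mul_polyC poly_actZ -poly_actC -mulrDl -poly_actD.
Qed.

Lemma poly_act_zmod : zmod_morphism poly_act.
Proof.
move=> a b; apply: (addIr (poly_act b)); rewrite -poly_actD subrK.
by rewrite -addrA addNr addr0.
Qed.

Lemma poly_act_monoid : monoid_morphism poly_act.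
Proof. by split; [rewrite -[1]/(1%:P) poly_actC Fscal1 | exact: poly_actM]. Qed.

HB.instance Definition _ := GRing.isZmodMorphism.Build {poly F} 'M[S]_d poly_act
  poly_act_zmod.
HB.instance Definition _ := GRing.isMonoidMorphism.Build {poly F} 'M[S]_d poly_act
  poly_act_monoid.

Lemma poly_act_X : poly_act 'X = T.
Proof. by rewrite -['X]mul1r poly_actX -[1]/(1%:P) poly_actC Fscal1 mul1r. Qed.

End PolyAct.
End TModule.

Section Gsu.
Context (F : finFieldType) (K : fieldType) (iota : {rmorphism {fraction {poly F}} -> K}).
Context (r : nat) (s : 'I_r -> nat) (u : 'I_r -> K).
Local Notation S := (skewpoly (frob iota)).

Definition dsz (m : 'I_r) : nat := \sum_(i < r | (m <= i)%N) s i.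

(* The index type 'I_(\sum_m dsz m) enumerates the pairs (m, j) lexicographically. *)
Definition Gdim : nat := \sum_(m < r) dsz m.

Definition Gnil : 'M[K]_Gdim :=
  \mxblock_(m < r, m' < r)
    \matrix_(i < dsz m, j < dsz m') ((m == m') && (j == i.+1 :> nat))%:R.

Definition Gtau : 'M[K]_Gdim :=
  \mxblock_(m < r, m' < r)
    \matrix_(i < dsz m, j < dsz m')
      (if [&& (m <= m')%N, i.+1 == dsz m & j == 0 :> nat]
       then (-1) ^+ (m' - m) * \prod_(k < r | (m <= k < m')%N) u k else 0).

Definition Gt : 'M[S]_Gdim :=
  map_mx (@skewC K (frob iota)) ((theta iota)%:M + Gnil)
  + map_mx (fun c => skewC (frob iota) c * tau (frob iota)) Gtau.

Lemma Gt_dpart : dpart Gt = (theta iota)%:M + Gnil.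
Proof.
apply/matrixP => i j; rewrite !mxE coefD coefC /=.
by rewrite coef_skew_mul big_ord1 coefX mulr0 addr0.
Qed.

Lemma Gnil_nilpotent : Gnil ^+ Gdim.+1 = 0.
Proof.
have Gnil_pow n i j : (Gnil ^+ n) i j != 0 ->
    (tagnat.sig2 j = tagnat.sig2 i + n :> nat)%N.
  elim: n i j => [|n IH] i j.
    have [->|/negPf ij] := eqVneq i j; first by rewrite addn0.
    by rewrite mxE ij eqxx.
  rewrite exprS -[_ * _]/(Gnil *m _) mxE => nz.
  have /existsP[k] : [exists k, Gnil i k * (Gnil ^+ n) k j != 0].
    apply: contraNT nz => /existsPn z; rewrite big1 // => k _.
    by apply/eqP; rewrite -[_ == _]negbK.
  rewrite mulf_eq0 negb_or => /andP[ik /IH ->].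
  move: ik; rewrite !mxE; case: andP => [[_ /eqP ->] _|]; last by rewrite eqxx.
  by rewrite addSnnS.
apply/matrixP => i j; rewrite [RHS]mxE; apply/eqP; apply: contraTT isT => /Gnil_pow e.
have := ltn_ord (tagnat.sig2 j); rewrite e ltnNge => /negP[].
rewrite (leq_trans _ (leq_addl _ _)) // (leq_trans _ (leqnSn _)) //.
by rewrite /Gdim (bigD1 (tagnat.sig1 j)) //= leq_addr.
Qed.

Lemma Gsu_nilpotent :
  exists n, (dpart (poly_act Gt 'X) - (theta iota)%:M) ^+ n = 0.
Proof.
by exists Gdim.+1; rewrite poly_act_X Gt_dpart addrC addKr Gnil_nilpotent.
Qed.

Definition Gsu : tmodule iota Gdim :=
  TModule (tact := poly_act Gt) (@poly_actZ F K iota Gdim Gt) Gsu_nilpotent.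

End Gsu.

Definition qmap (q i : nat) (L : fieldType) m n (M : 'M[L]_(m, n)) : 'M[L]_(m, n) :=
  map_mx (fun x => x ^+ (q ^ i)) M.

(* An F_q-linear power series in d variables, z |-> sum_i P_i z^(i), is given by its
   sequence of coefficients P_i; it is z modulo degree q when P_0 = 1. *)
Definition qseries (K : fieldType) (d : nat) := nat -> 'M[K]_d.

Section ExpLog.
Context (F : finFieldType) (K : fieldType) (iota : {rmorphism {fraction {poly F}} -> K}).
Context (d : nat) (G : tmodule iota d).
Local Notation q := #|F|.

Definition qcomp (P Q : qseries K d) : qseries K d :=
  fun n => \sum_(i < n.+1) P i *m qmap q i (Q (n - i)%N).

Definition qid : qseries K d := fun n => if n is 0 then 1%:M else 0.

Definition qconst (M : 'M[K]_d) : qseries K d := fun n => if n is 0 then M else 0.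

Definition is_exp (P : qseries K d) : Prop :=
  P 0 = 1%:M /\
  forall a : {poly F}, qcomp P (qconst (dpart (G a))) = qcomp (tcoef (G a)) P.

(* [is_exp] has a unique solution; [xget] selects it, and likewise its inverse. *)
Definition exp_series : qseries K d := xget (fun=> 0) [set P | is_exp P].

Definition log_series : qseries K d :=
  xget (fun=> 0) [set P | qcomp exp_series P = qid /\ qcomp P exp_series = qid].

(* G(R) = R^d, which makes sense only when G is defined over the subring R. *)
Definition Gpoints (R : set K) : set 'cV[K]_d :=
  [set z | (forall i a b, R (tcoef (G 'X) i a b)) /\ forall a, R (z a 0)].

End ExpLog.

(* Non-archimedean absolute values. Those on F_q(theta) are pinned down by a single value:
   |theta| = q gives the place at infinity, and |v| = 1/q_v gives the place v. *)
Record absval (R : realType) (C : fieldType) := AbsVal {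
  abs :> C -> R;
  abs_ge0 : forall x, 0 <= abs x;
  abs_eq0 : forall x, (abs x == 0) = (x == 0);
  absM : forall x y, abs (x * y) = abs x * abs y;
  abs_ultra : forall x y, abs (x + y) <= Num.max (abs x) (abs y) }.

Section AbsVal.
Context (R : realType) (C : fieldType) (w : absval R C).

Lemma abs0 : w 0 = 0.
Proof. by apply/eqP; rewrite abs_eq0. Qed.

Lemma abs1 : w 1 = 1.
Proof.
have nz : w 1 != 0 by rewrite abs_eq0 oner_eq0.
by apply: (mulfI nz); rewrite -absM !mulr1.
Qed.

Lemma absN x : w (- x) = w x.
Proof.
have /eqP : w (-1) ^+ 2 = 1 by rewrite expr2 -absM mulrNN mulr1 abs1.
rewrite sqrf_eq1 => /orP[/eqP wN1|/eqP wN1].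
  by rewrite -mulN1r absM wN1 mul1r.
by have := abs_ge0 w (-1); rewrite wN1 lerNr oppr0 ler10.
Qed.

Definition vlim (s : nat -> C) (l : C) : Prop :=
  (fun n => w (s n - l)) @ \oo --> (0 : R).

Definition vcauchy (s : nat -> C) : Prop :=
  forall e : R, 0 < e ->
    exists N, forall m n, (N <= m)%N -> (N <= n)%N -> w (s m - s n) < e.

Definition mxabs m n (M : 'M[C]_(m, n)) : R :=
  \big[Num.max/0]_(i < m) \big[Num.max/0]_(j < n) w (M i j).

Definition mxlim m n (s : nat -> 'M[C]_(m, n)) (l : 'M[C]_(m, n)) : Prop :=
  (fun k => mxabs (s k - l)) @ \oo --> (0 : R).

(* C is the completion of an algebraic closure of the completion k_w of k: k_w is
   realized as the closure of i(k), and its algebraic closure as the field of elements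
   of C that are algebraic over k_w. *)
Section Completion.
Context (k : fieldType) (i : k -> C).

Definition base_completion : set C :=
  [set x | exists s : nat -> k, vlim (i \o s) x].

Definition base_algclosure : set C :=
  [set x | exists p : {poly C},
    [/\ p != 0, forall n, base_completion p`_n & root p x]].

Definition completed_algclosure : Prop :=
  [/\ forall s, vcauchy s -> exists l, vlim s l,
      forall p : {poly C}, (1 < size p)%N -> (forall n, base_algclosure p`_n) ->
        exists2 x, base_algclosure x & root p x
    & forall x, exists2 s : nat -> C, forall n, base_algclosure (s n) & vlim s x].

End Completion.

Section Evaluation.
Context (q : nat) (K : fieldType) (j : K -> C) (d : nat).
Context (P : qseries K d) (z : 'cV[C]_d).

Definition qsum (n : nat) : 'cV[C]_d :=
  \sum_(i < n) map_mx j (P i) *m qmap q i z.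

Definition qcvg : Prop := exists l, mxlim qsum l.

Definition qeval : 'cV[C]_d := xget 0 [set l | mxlim qsum l].

End Evaluation.

Record valring := ValRing { valring_val :> C; valringP : w valring_val <= 1 }.

HB.instance Definition _ := [isSub for valring_val].
HB.instance Definition _ := [Choice of valring by <:].

Lemma valring_closed : subring_closed [pred x | w x <= 1].
Proof.
split=> [|x y|x y]; rewrite !inE ?abs1 // => wx wy.
  by rewrite (le_trans (abs_ultra _ _ _)) // ge_max wx absN.
by rewrite absM mulr_ile1 ?abs_ge0.
Qed.

HB.instance Definition _ :=
  GRing.SubChoice_isSubComNzRing.Build C _ valring valring_closed.

Definition maxideal : {pred valring} := [pred x : valring | w (val x) < 1].

Lemma maxideal_closed : idealr_closed maxideal.
Proof.
split=> [||a x y]; rewrite !inE /= ?abs0 ?abs1 ?ltr01 ?ltxx // => wx wy.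
rewrite (le_lt_trans (abs_ultra _ _ _)) // gt_max wy andbT absM.
by rewrite (le_lt_trans _ wx) // ler_piMl ?abs_ge0 ?valringP.
Qed.

HB.instance Definition _ := isIdealr.Build valring maxideal maxideal_closed.

Definition residue_ring : comNzRingType := {ideal_quot maxideal}.

Definition residue (x : valring) : residue_ring := \pi_({ideal_quot maxideal})%qT x.

End AbsVal.

(* The subfield with N elements of the residue field. *)
Definition in_subfield_card (kappa : comNzRingType) (N : nat) (y : kappa) : Prop :=
  exists S : seq kappa,
    [/\ uniq S, size S = N,
        [/\ 1 \in S, {in S &, forall a b, a - b \in S}
          & {in S &, forall a b, a * b \in S}],
        {in S, forall a, a != 0 -> exists2 b, b \in S & a * b = 1}
      & y \in S].

Definition integral_at (R : realType) (K C : fieldType) (w : absval R C) (j : K -> C) :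
    set K := [set x | w (j x) <= 1].

(* The set A_(v),l, where N = q_v ^ l. *)
Definition residue_in (R : realType) (K C : fieldType) (w : absval R C) (j : K -> C)
    (N : nat) : set K :=
  [set x | exists x_int : w (j x) <= 1, in_subfield_card N (residue (ValRing x_int))].

(* Only the first coordinate (index 0) satisfies a strict bound. *)
Definition Dinf (R : realType) (C : fieldType) (w : absval R C) (q r : nat)
    (n : 'I_r -> nat) : set ('I_r -> C) :=
  [set z | forall i,
     let b : R := q%:R `^ ((n i)%:R * q%:R / (q%:R - 1)) in
     if i == 0 :> nat then w (z i) < b else w (z i) <= b].

Definition DDef (R : realType) (K Cinf Cv : fieldType)
    (winf : absval R Cinf) (jinf : K -> Cinf) (wv : absval R Cv) (jv : K -> Cv)
    (q r : nat) (n : 'I_r -> nat) : set ('I_r -> K) :=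
  [set z | Dinf winf q n (fun i => jinf (z i)) /\ forall i, wv (jv (z i)) <= 1].

Definition isometry_nbhs0 (R : realType) (C : fieldType) (w : absval R C) (d : nat)
    (f : 'cV[C]_d -> 'cV[C]_d) (D : set 'cV[C]_d) : Prop :=
  (exists2 e : R, 0 < e & forall z, mxabs w z < e -> D z) /\
  forall x y, D x -> D y -> mxabs w (f x - f y) = mxabs w (x - y).

(* Main.v *)
Require Import Defs.
From HB Require Import structures.
From mathcomp Require Import all_boot all_order all_algebra all_field.
From mathcomp Require Import all_classical all_reals all_analysis.
From mathcomp Require Import zify.
Set Implicit Arguments.
Unset Strict Implicit.
Unset Printing Implicit Defensive.
Import Order.TTheory GRing.Theory Num.Theory.
Import numFieldNormedType.Exports.
Local Open Scope classical_set_scope.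
Local Open Scope ring_scope.

(** At infinity everything reduces to [exp (log x) = x], which holds as soon as [log x] converges
    because [exp] is entire, to [log (exp z) = z] near 0, and to the fact that [∂[v]^(q^e)] is the
    scalar matrix [v(theta)^(q^e)], whence [Z_n -> 0]. The point [v_n] is algebraic because the
    kbar-span of 1 and the first block coordinates along its [t]-orbit is finite dimensional and
    stable under the q-power map.

    For the place [v], let [F_m(k)] be the first coordinate of the m-th block of [[t^k]z]. Writing
    [S] for the shift in [k], the definition of the t-module becomes
    [(S - theta)^(d_m) F_m = sum_(m' >= m) c_mm' F_m'^q] with [c_mm = 1]. If [F_m' = 0] for
    [m' > m], iterating [D = deg v] times gives
    [F_m^(q^D) = prod_(i < D) (S - theta^(q^i))^(d_m) F_m], and modulo [v] the right-hand side is
    [v(S)^(d_m) F_m]. So on the m-th graded piece [v^(d_m)] acts as the [q_v]-Frobenius: for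
    [d_m | n], [v^n] is injective on residues, the residues of [v_n] inherit from those of [v]
    that they lie in the field with [q_v^l] elements, and [v^(d_m l) - 1] kills the m-th piece. *)

(** * The shift module and triangular Frobenius systems *)

(** [v_n] is defined at infinity and has to be small at [v], and the two places meet only in [kbar]:
    hence the algebraicity argument, after which [v^n]v_n = v is all that is known about [v_n] at
    [v]. Nothing can be reduced before the integrality of [v_n] has been recovered from that
    equation. Divisibility of n by every d_m makes [v^n], on each graded piece, a whole power of the
    injective q_v-Frobenius. The splitting of v(S) modulo [v] comes from a root of [v] in [kbar]
    that is congruent to theta.

    The coefficients of exp and log obey recurrences of one shape, (theta^(q^n) - theta) X - [N, X]
    = Y with Y known. At infinity the scalar dominates ad N. At [v] it may be small, but is at least
    |v(theta)| because [v] divides X^(q^n) - X at most once; nilpotency of ad N then limits the loss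
    per coefficient to a fixed factor, so the coefficients of log grow at most geometrically and log
    converges on the open unit ball. *)

Section ShiftAction.
Context (R : comNzRingType).
Implicit Types (g h : {poly R}) (s : nat -> R).

(* Sequences form a module over {poly R}, with 'X acting as the shift. *)
Definition act g s : nat -> R := fun k => \sum_(i < size g) g`_i * s (k + i)%N.

Lemma act_widen n g s k : (size g <= n)%N ->
  act g s k = \sum_(i < n) g`_i * s (k + i)%N.
Proof.
move=> le_gn; rewrite /act (big_ord_widen n (fun i => g`_i * s (k + i)%N)) //.
rewrite big_mkcond; apply: eq_bigr => i _; case: ltnP => // le_gi.
by rewrite nth_default // mul0r.
Qed.

Lemma eq_act g s s' : s =1 s' -> act g s =1 act g s'.
Proof. by move=> e k; apply: eq_bigr => i _; rewrite e. Qed.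

Lemma actD g h s k : act (g + h) s k = act g s k + act h s k.
Proof.
rewrite (act_widen _ _ (size_polyD g h)) (act_widen _ _ (leq_maxl (size g) (size h))).
rewrite (act_widen _ _ (leq_maxr (size g) (size h))) -big_split /=.
by apply: eq_bigr => i _; rewrite coefD mulrDl.
Qed.

Lemma actZ c g s k : act (c *: g) s k = c * act g s k.
Proof.
rewrite (act_widen _ _ (size_scale_leq c g)) big_distrr /=.
by apply: eq_bigr => i _; rewrite coefZ mulrA.
Qed.

Lemma actB g h s k : act (g - h) s k = act g s k - act h s k.
Proof. by rewrite actD -scaleN1r actZ mulN1r. Qed.

Lemma actC c s k : act c%:P s k = c * s k.
Proof. by rewrite (act_widen _ _ (size_polyC_leq1 c)) big_ord1 coefC addn0. Qed.

Lemma act1 s k : act 1 s k = s k.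
Proof. by rewrite -[1]/(1%:P) actC mul1r. Qed.

Lemma actMX g s k : act (g * 'X) s k = act g s k.+1.
Proof.
have le_g : (size (g * 'X)%R <= (size g).+1)%N.
  by rewrite (leq_trans (size_polyMleq _ _)) // size_polyX addn2.
rewrite (act_widen _ _ le_g) big_ord_recl coefMX mul0r add0r.
by apply: eq_bigr => i _; rewrite coefMX /= addnS.
Qed.

Lemma actX s k : act 'X s k = s k.+1.
Proof. by rewrite -['X]mul1r actMX act1. Qed.

Lemma act_mul g h s k : act (g * h) s k = act g (act h s) k.
Proof.
elim/poly_ind: g k => [|g c IH] k.
  by rewrite mul0r -[0]/(0%:P) !actC !mul0r.
by rewrite mulrDl -mulrA ['X * h]mulrC mulrA !actD !actMX IH actC mul_polyC actZ.
Qed.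

Lemma actCA g h s k : act g (act h s) k = act h (act g s) k.
Proof. by rewrite -!act_mul mulrC. Qed.

Lemma act0r g s k : s =1 (fun=> 0) -> act g s k = 0.
Proof. by move=> s0; apply: big1 => i _; rewrite s0 mulr0. Qed.

Lemma actBr g s s' k : act g (fun k => s k - s' k) k = act g s k - act g s' k.
Proof. by rewrite /act -sumrB; apply: eq_bigr => i _; rewrite mulrBr. Qed.

Lemma act_lincomb (I : Type) (l : seq I) (P : pred I) (c : I -> R) (s : I -> nat -> R) g k :
  act g (fun k => \sum_(i <- l | P i) c i * s i k) k
    = \sum_(i <- l | P i) c i * act g (s i) k.
Proof.
rewrite /act; under eq_bigr do rewrite big_distrr /=.
rewrite exchange_big /=; apply: eq_bigr => i _; rewrite big_distrr /=.
by apply: eq_bigr => j _; rewrite mulrCA.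
Qed.

End ShiftAction.

Lemma act_map (R R' : comNzRingType) (f : {rmorphism R -> R'}) (g : {poly R})
    (s : nat -> R) k :
  f (act g s k) = act (map_poly f g) (f \o s) k.
Proof.
rewrite rmorph_sum (act_widen _ _ (size_poly _ _)); apply: eq_bigr => i _.
by rewrite rmorphM coef_map.
Qed.

Lemma map_polyXsubC_exp (R R' : comNzRingType) (f : {rmorphism R -> R'}) c n :
  map_poly f (('X - c%:P) ^+ n) = ('X - (f c)%:P) ^+ n.
Proof. by rewrite rmorphXn rmorphB /= map_polyX map_polyC. Qed.

Section TriangularSystem.
Context (R : comNzRingType) (phi : {rmorphism R -> R}).
Context (r : nat) (dm : 'I_r -> nat) (th : R) (c : 'I_r -> 'I_r -> R).
Hypothesis c_diag : forall m, c m m = 1.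
Implicit Types F : 'I_r -> nat -> R.

(* The equations satisfied by the sequences [F m] of first coordinates of the m-th blocks of
   [t^k]z, with 'X in the role of t. *)
Definition trisol F := forall m k,
  act (('X - th%:P) ^+ dm m) (F m) k = \sum_(m' < r | (m <= m')%N) c m m' * phi (F m' k).

Definition supp_le F (m : nat) := forall m' : 'I_r, (m < m')%N -> F m' =1 (fun=> 0).

Lemma trisol_iter F (m : 'I_r) : trisol F -> supp_le F m -> forall j k,
  iter j phi (F m k) = act (\prod_(i < j) ('X - (iter i phi th)%:P) ^+ dm m) (F m) k.
Proof.
move=> solF F0; elim=> [|j IH] k; first by rewrite big_ord0 act1.
have phiF : phi \o F m =1 act (('X - th%:P) ^+ dm m) (F m).
  move=> k'; rewrite solF (bigD1 m) //= c_diag mul1r big1 ?addr0 // => m' /andP[le_m ne_m].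
  by rewrite F0 ?rmorph0 ?mulr0 // ltn_neqAle le_m andbT eq_sym.
rewrite iterS IH act_map (eq_act _ phiF) -act_mul big_ord_recl mulrC /=.
by congr (act (_ * _) _ _); rewrite rmorph_prod; apply: eq_bigr => i _; apply: map_polyXsubC_exp.
Qed.

Lemma trisol_act F b : map_poly phi b = b -> trisol F -> trisol (fun m => act b (F m)).
Proof.
move=> phib solF m k; rewrite actCA (eq_act _ (solF m)).
rewrite (act_lincomb _ _ (c m) (fun m' k => phi (F m' k))).
by apply: eq_bigr => m' _; rewrite act_map phib.
Qed.

(** The equations are additive in [F], so the defect [sg F - F] solves them again, and proving
    [sg F = F] becomes proving that a solution vanishes. *)
Lemma trisol_aut F (sg : {rmorphism R -> R}) :
    (forall x, sg (phi x) = phi (sg x)) -> sg th = th -> (forall m m', sg (c m m') = c m m') ->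
  trisol F -> trisol (fun m k => sg (F m k) - F m k).
Proof.
move=> sgphi sgth sgc solF m k; rewrite actBr solF.
have := congr1 sg (solF m k); rewrite act_map map_polyXsubC_exp sgth.
move=> ->; rewrite rmorph_sum -sumrB; apply: eq_bigr => m' _.
by rewrite rmorphM sgc sgphi rmorphB mulrBr.
Qed.

Context (D l : nat) (V : {poly R}) (sg : {rmorphism R -> R}).
Hypothesis phi_inj : injective phi.
Hypothesis V_phi : map_poly phi V = V.
Hypothesis V_prod : V = \prod_(i < D) ('X - (iter i phi th)%:P).
Hypothesis th_period : iter D phi th = th.
Hypothesis sg_iter : forall x, sg x = iter (D * l) phi x.
Hypothesis sg_c : forall m m', sg (c m m') = c m m'.

(** Since [th] has period [D] under [phi], the [D * j] factors run [j] times through the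
    factorisation of [V]. *)
Lemma prod_period j e :
  \prod_(i < D * j) ('X - (iter i phi th)%:P) ^+ e = V ^+ (e * j).
Proof.
elim: j => [|j IH]; first by rewrite !muln0 big_ord0.
rewrite mulnS addnC big_split_ord /= IH mulnS addnC exprD; congr (_ * _).
rewrite V_prod prodrXl; congr (_ ^+ e); apply: eq_bigr => i _.
rewrite addnC iterD; suff -> : iter (D * j) phi th = th by [].
by elim: (j) => [|j' IH']; rewrite ?muln0 // mulnS iterD IH' th_period.
Qed.

Lemma iter_inj0 j x : iter j phi x = 0 -> x = 0.
Proof. by elim: j => //= j IH e; apply/IH/phi_inj; rewrite e rmorph0. Qed.

Lemma sg_th : sg th = th.
Proof. by rewrite sg_iter; elim: (l) => [|j IH]; rewrite ?muln0 // mulnS iterD IH. Qed.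

Lemma sg_phi x : sg (phi x) = phi (sg x).
Proof. by rewrite !sg_iter -iterSr. Qed.

Lemma descending_ind (P : 'I_r -> Prop) :
  (forall m : 'I_r, (forall m' : 'I_r, (m < m')%N -> P m') -> P m) -> forall m, P m.
Proof.
move=> IH m; have [e] := ubnP (r - m)%N; elim: e m => // e IHe m lt_e.
apply: IH => m' lt_m; apply: IHe; have := ltn_ord m'; lia.
Qed.

(** Once the blocks above [m] vanish, [trisol_iter] turns [V ^+ n], with n = dm m * e, into the
    [D * e]-th iterate of [phi] on [F m], and [phi] is injective. *)
Lemma trisol_inj F n : (forall m, dm m %| n)%N -> trisol F ->
  (forall m k, act (V ^+ n) (F m) k = 0) -> forall m k, F m k = 0.
Proof.
move=> dvd_n solF F0; apply: descending_ind => m Fm0 k.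
have [e def_n] := dvdnP (dvd_n m); apply: (iter_inj0 (j := D * e)).
by rewrite (trisol_iter solF Fm0) prod_period mulnC -def_n F0.
Qed.

Lemma trisol_annihilated F n : (forall m, dm m %| n)%N -> trisol F ->
    (forall m k, sg (act (V ^+ n) (F m) k) = act (V ^+ n) (F m) k) ->
  forall m k, act (\prod_(i < r) (V ^+ (dm i * l) - 1)) (F m) k = 0.
Proof.
move=> dvd_n solF sgF.
have phiVX j : map_poly phi (V ^+ j) = V ^+ j by rewrite rmorphXn /= V_phi.
have sgVX j : map_poly sg (V ^+ j) = V ^+ j.
  apply/polyP => i; rewrite coef_map /= sg_iter.
  elim: (_ * l)%N => //= e ->; by rewrite -{2}(phiVX j) coef_map.
(* The defect [sg F - F] is a solution killed by [V ^+ n], hence zero. *)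
have sgFF m k : sg (F m k) = F m k.
  apply: subr0_eq; move: m k; apply: (trisol_inj dvd_n (trisol_aut sg_phi sg_th sg_c solF)).
  move=> m k; rewrite actBr; apply/eqP; rewrite subr_eq0; apply/eqP.
  by rewrite -[RHS]sgF act_map sgVX.
pose a i := V ^+ (dm i * l) - 1.
have phia (P : pred 'I_r) : map_poly phi (\prod_(i < r | P i) a i) = \prod_(i < r | P i) a i.
  by rewrite rmorph_prod; apply: eq_bigr => i _; rewrite rmorphB rmorph1 /= phiVX.
have sga (P : pred 'I_r) : map_poly sg (\prod_(i < r | P i) a i) = \prod_(i < r | P i) a i.
  by rewrite rmorph_prod; apply: eq_bigr => i _; rewrite rmorphB rmorph1 /= sgVX.
(* Applying [b], the factors of the higher blocks, clears those blocks; on what remains in block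
   [m], [V ^+ (dm m * l)] acts as [sg], which fixes it. *)
have vanish : forall (m : 'I_r) k, act (\prod_(i < r | (m <= i)%N) a i) (F m) k = 0.
  apply: descending_ind => m IH k.
  pose b := \prod_(i < r | (m < i)%N) a i.
  have split_b : \prod_(i < r | (m <= i)%N) a i = a m * b.
    rewrite (bigD1 m) //=; congr (_ * _); apply: eq_bigl => i.
    by rewrite ltn_neqAle andbC eq_sym.
  have bF0 : supp_le (fun m => act b (F m)) m.
    move=> m' lt_m k'; rewrite /b (bigID (fun i : 'I_r => (m' <= i)%N)) /=.
    rewrite mulrC act_mul; apply: act0r => k''.
    rewrite -(IH m' lt_m k''); congr (act _ _ _); apply: eq_bigl => i.
    by rewrite andbC andb_idr // => /(leq_trans lt_m).
  rewrite split_b act_mul actB act1 mulnC [(l * _)%N]mulnC -prod_period.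
  rewrite -(trisol_iter (trisol_act (phia _) solF) bF0) -sg_iter act_map sga.
  by apply/eqP; rewrite subr_eq0; apply/eqP; apply: eq_act => j /=; rewrite sgFF.
move=> m k; rewrite (bigID (fun i : 'I_r => (m <= i)%N)) /= mulrC act_mul.
by apply: act0r => k'; apply: vanish.
Qed.

End TriangularSystem.

(** * Ultrametric norms and convergence *)

Section NullSequences.
Context (R : realType).
Implicit Types a b : nat -> R.

(** One-sided: it means convergence to 0 for nonnegative sequences such as norms, and passes to
    smaller sequences without sign conditions. *)
Definition null_seq a := forall e : R, 0 < e -> exists N, forall n, (N <= n)%N -> a n < e.

Lemma null_seqP a : (forall n, 0 <= a n) -> a @ \oo --> (0 : R) <-> null_seq a.
Proof.
move=> a_ge0; split=> [/cvgr0Pnorm_lt a0 e e0|a0].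
  have [N _ HN] := a0 e e0; exists N => n /HN /=.
  by rewrite ger0_norm.
apply/cvgr0Pnorm_lt => e /a0 [N HN]; exists N => // n /HN /=.
by rewrite ger0_norm.
Qed.

Lemma null_seq_le a b N : (forall n, (N <= n)%N -> a n <= b n) -> null_seq b -> null_seq a.
Proof.
move=> le_ab b0 e /b0 [M HM]; exists (maxn N M) => n; rewrite geq_max => /andP[/le_ab l /HM].
exact: le_lt_trans.
Qed.

Lemma null_seqZ c a : 0 <= c -> null_seq a -> null_seq (fun n => c * a n).
Proof.
(* Dividing by [c + 1] avoids a case [c = 0]; the sign of [a n] matters because null sequences are
   bounded only from above. *)
move=> c0 a0 e e0; have c1 : 0 < c + 1 by rewrite ltr_wpDl.
have [N HN] := a0 (e / (c + 1)) (divr_gt0 e0 c1); exists N => n /HN.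
rewrite ltr_pdivlMr // => h; have [a_ge0|/ltW a_le0] := leP 0 (a n).
  by apply: le_lt_trans h; rewrite mulrC ler_wpM2l // lerDl.
by apply: le_lt_trans e0; rewrite mulr_ge0_le0.
Qed.

Lemma null_seq_max a b : null_seq a -> null_seq b -> null_seq (fun n => Num.max (a n) (b n)).
Proof.
move=> a0 b0 e e0; have [N HN] := a0 e e0; have [M HM] := b0 e e0.
by exists (maxn N M) => n; rewrite geq_max gt_max => /andP[/HN -> /HM ->].
Qed.

Lemma null_seq_geo (x : R) : 0 <= x < 1 -> null_seq (fun n => x ^+ n).
Proof.
move=> /andP[x0 x1]; apply/null_seqP => [n|]; first exact: exprn_ge0.
by apply: cvg_expr; rewrite ger0_norm.
Qed.

End NullSequences.

Section MatrixNorm.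
Context (R : realType) (C : fieldType) (w : absval R C).

Lemma absX x n : w (x ^+ n) = w x ^+ n.
Proof. by elim: n => [|n IH]; rewrite ?expr0 ?abs1 // !exprS absM IH. Qed.

Lemma absV x : w x^-1 = (w x)^-1.
Proof.
have [->|x0] := eqVneq x 0; first by rewrite invr0 abs0 invr0.
have wx0 : w x != 0 by rewrite abs_eq0.
by apply: (mulfI wx0); rewrite -absM !divff // abs1.
Qed.

Lemma abs_prod (I : Type) (l : seq I) (P : pred I) (G : I -> C) :
  w (\prod_(i <- l | P i) G i) = \prod_(i <- l | P i) w (G i).
Proof. exact: (big_morph _ (absM w) (abs1 w)). Qed.

Lemma absB_le x y b : w x <= b -> w y <= b -> w (x - y) <= b.
Proof. by move=> wx wy; rewrite (le_trans (abs_ultra _ _ _)) // ge_max wx absN. Qed.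

Lemma absD_le x y b : w x <= b -> w y <= b -> w (x + y) <= b.
Proof. by move=> wx wy; rewrite (le_trans (abs_ultra _ _ _)) // ge_max wx. Qed.

Lemma absD_lt x y b : w x < b -> w y < b -> w (x + y) < b.
Proof. by move=> wx wy; rewrite (le_lt_trans (abs_ultra _ _ _)) // gt_max wx. Qed.

Lemma abs_sum_le (I : Type) (l : seq I) (P : pred I) (G : I -> C) b :
  0 <= b -> (forall i, P i -> w (G i) <= b) -> w (\sum_(i <- l | P i) G i) <= b.
Proof.
by move=> b0 Gb; elim/big_ind: _ => //; [rewrite abs0 | move=> x y; apply: absD_le].
Qed.

Lemma absD_dominant x y : w y < w x -> w (x + y) = w x.
Proof.
move=> lt_yx; apply/eqP; rewrite eq_le absD_le ?(ltW lt_yx) //=.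
rewrite leNgt; apply/negP => h; have : w (x + y - y) < w x.
  by rewrite absD_lt ?absN.
by rewrite addrK ltxx.
Qed.

Lemma mxabs_ge0 m n (A : 'M[C]_(m, n)) : 0 <= mxabs w A.
Proof.
rewrite /mxabs; elim/big_ind: _ => // [x y x0 y0|i _]; first by rewrite le_max x0.
elim/big_ind: _ => // [x y x0 y0|j _]; [by rewrite le_max x0 | exact: abs_ge0].
Qed.

Lemma mxabs_leP m n (A : 'M[C]_(m, n)) b : 0 <= b ->
  reflect (forall i j, w (A i j) <= b) (mxabs w A <= b).
Proof.
move=> b0; apply: (iffP (bigmax_leP _ _ _ _)) => [[_ h] i j|h].
  by have /bigmax_leP[_] := h i isT; apply.
by split=> // i _; apply/bigmax_leP; split.
Qed.

Lemma le_mxabs m n (A : 'M[C]_(m, n)) i j : w (A i j) <= mxabs w A.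
Proof. by move: i j; apply/mxabs_leP => //; exact: mxabs_ge0. Qed.

Lemma mxabs_ltP m n (A : 'M[C]_(m, n)) b : 0 < b ->
  reflect (forall i j, w (A i j) < b) (mxabs w A < b).
Proof.
move=> b0; apply: (iffP idP) => [h i j|h]; first exact: le_lt_trans (le_mxabs _ _ _) h.
by apply/bigmax_ltP; split=> // i _; apply/bigmax_ltP; split=> // j _.
Qed.

Lemma mxabs_eq0P m n (A : 'M[C]_(m, n)) : mxabs w A = 0 -> A = 0.
Proof.
move=> A0; apply/matrixP => i j; rewrite mxE; apply/eqP; rewrite -(abs_eq0 w).
by rewrite eq_le abs_ge0 andbT -A0 le_mxabs.
Qed.

Lemma mxabs0 m n : mxabs w (0 : 'M[C]_(m, n)) = 0.
Proof.
apply/eqP; rewrite eq_le mxabs_ge0 andbT; apply/mxabs_leP => // i j.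
by rewrite mxE abs0.
Qed.

Lemma mxabsN m n (A : 'M[C]_(m, n)) : mxabs w (- A) = mxabs w A.
Proof. by apply: eq_bigr => i _; apply: eq_bigr => j _; rewrite mxE absN. Qed.

Lemma mxabsD m n (A B : 'M[C]_(m, n)) : mxabs w (A + B) <= Num.max (mxabs w A) (mxabs w B).
Proof.
apply/mxabs_leP => [|i j]; first by rewrite le_max mxabs_ge0.
by rewrite mxE absD_le // le_max le_mxabs ?orbT.
Qed.

Lemma mxabsD_le m n (A B : 'M[C]_(m, n)) b :
  mxabs w A <= b -> mxabs w B <= b -> mxabs w (A + B) <= b.
Proof. by move=> Ab Bb; rewrite (le_trans (mxabsD _ _)) // ge_max Ab. Qed.

Lemma mxabsD_lt m n (A B : 'M[C]_(m, n)) b :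
  mxabs w A < b -> mxabs w B < b -> mxabs w (A + B) < b.
Proof. by move=> Ab Bb; rewrite (le_lt_trans (mxabsD _ _)) // gt_max Ab. Qed.

Lemma mxabsB_le m n (A B : 'M[C]_(m, n)) b :
  mxabs w A <= b -> mxabs w B <= b -> mxabs w (A - B) <= b.
Proof. by move=> Ab Bb; rewrite mxabsD_le // mxabsN. Qed.

Lemma mxabs_sum_le m n (I : Type) (l : seq I) (P : pred I) (G : I -> 'M[C]_(m, n)) b :
  0 <= b -> (forall i, P i -> mxabs w (G i) <= b) ->
  mxabs w (\sum_(i <- l | P i) G i) <= b.
Proof.
by move=> b0 Gb; elim/big_ind: _ => //; [rewrite mxabs0 | move=> x y; apply: mxabsD_le].
Qed.

Lemma mxabs_sum_lt m n (I : finType) (P : pred I) (G : I -> 'M[C]_(m, n)) b :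
  0 < b -> (forall i, P i -> mxabs w (G i) < b) -> mxabs w (\sum_(i | P i) G i) < b.
Proof.
by move=> b0 Gb; elim/big_ind: _ => //; [rewrite mxabs0 | move=> x y; apply: mxabsD_lt].
Qed.

Lemma mxabsM m n p (A : 'M[C]_(m, n)) (B : 'M[C]_(n, p)) :
  mxabs w (A *m B) <= mxabs w A * mxabs w B.
Proof.
have AB0 : 0 <= mxabs w A * mxabs w B by rewrite mulr_ge0 ?mxabs_ge0.
apply/mxabs_leP => // i j; rewrite mxE; apply: abs_sum_le => // k _.
by rewrite absM ler_pM ?abs_ge0 ?le_mxabs.
Qed.

Lemma mxabsZ m n c (A : 'M[C]_(m, n)) : mxabs w (c *: A) = w c * mxabs w A.
Proof.
have h c' (B : 'M[C]_(m, n)) : mxabs w (c' *: B) <= w c' * mxabs w B.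
  apply/mxabs_leP => [|i j]; first by rewrite mulr_ge0 ?abs_ge0 ?mxabs_ge0.
  by rewrite mxE absM ler_wpM2l ?abs_ge0 ?le_mxabs.
apply/eqP; rewrite eq_le h /=; have [->|c0] := eqVneq c 0.
  by rewrite abs0 mul0r mxabs_ge0.
have wc : 0 < w c by rewrite lt_neqAle abs_ge0 andbT eq_sym abs_eq0.
rewrite mulrC -ler_pdivlMr // mulrC -absV -{1}[A](scalerK c0) //; exact: h.
Qed.

Lemma mxabs_scalar_le n c : mxabs w (c%:M : 'M[C]_n) <= w c.
Proof.
apply/mxabs_leP => [|i j]; first exact: abs_ge0.
by rewrite mxE; case: eqP => _ //=; rewrite mulr0n abs0 abs_ge0.
Qed.

Lemma mxabs1_le n : mxabs w (1%:M : 'M[C]_n) <= 1.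
Proof. by rewrite (le_trans (mxabs_scalar_le _ _)) // abs1. Qed.

Lemma mxabs_qmap q i m n (A : 'M[C]_(m, n)) : mxabs w (qmap q i A) <= mxabs w A ^+ (q ^ i).
Proof.
apply/mxabs_leP => [|a b]; first by rewrite exprn_ge0 ?mxabs_ge0.
by rewrite mxE absX lerXn2r ?nnegrE ?abs_ge0 ?mxabs_ge0 ?le_mxabs.
Qed.

Definition vcomplete := forall s, vcauchy w s -> exists l, vlim w s l.

Lemma mxlimP m n (s : nat -> 'M[C]_(m, n)) l :
  mxlim w s l <-> null_seq (fun k => mxabs w (s k - l)).
Proof. by apply: null_seqP => k; apply: mxabs_ge0. Qed.

Lemma mxlim_unique m n (s : nat -> 'M[C]_(m, n)) l l' :
  mxlim w s l -> mxlim w s l' -> l = l'.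
Proof.
move=> /mxlimP sl /mxlimP sl'; apply/eqP; rewrite -subr_eq0; apply/eqP/mxabs_eq0P.
apply/eqP; rewrite eq_le mxabs_ge0 andbT leNgt; apply/negP => d0.
have [N HN] := sl _ d0; have [N' HN'] := sl' _ d0; set k := maxn N N'.
have := mxabsD_lt (HN' k (leq_maxr _ _)) (_ : mxabs w (l - s k) < mxabs w (l - l')).
rewrite -mxabsN opprB HN ?leq_maxl // => /(_ isT).
by rewrite addrC addrA subrK ltxx.
Qed.

Lemma mxlim_bound m n (s : nat -> 'M[C]_(m, n)) l b : 0 <= b ->
  mxlim w s l -> (forall k, mxabs w (s k) <= b) -> mxabs w l <= b.
Proof.
move=> b0 /mxlimP sl sb; rewrite leNgt; apply/negP => lb.
have [N HN] := sl _ (le_lt_trans b0 lb).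
have := mxabsD_lt (HN N (leqnn _)) (_ : mxabs w (- s N) < mxabs w l).
by rewrite mxabsN (le_lt_trans (sb N)) // => /(_ isT); rewrite addrAC addrN sub0r mxabsN ltxx.
Qed.

Lemma eq_mxlim m n (s s' : nat -> 'M[C]_(m, n)) l :
  null_seq (fun k => mxabs w (s k - s' k)) -> mxlim w s l -> mxlim w s' l.
Proof.
move=> ss' /mxlimP sl; apply/mxlimP; apply: (null_seq_le (N := 0)) (null_seq_max ss' sl) => k _.
rewrite -[s' k - l](subrKA (s k)) -[X in Num.max X _]mxabsN opprB.
exact: mxabsD.
Qed.

(** By the ultrametric inequality, consecutive differences bound all later ones, so a sequence is
    Cauchy as soon as they tend to 0. *)
Lemma mx_series_cvg m n (s : nat -> 'M[C]_(m, n)) : vcomplete ->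
  null_seq (fun k => mxabs w (s k.+1 - s k)) -> exists l, mxlim w s l.
Proof.
move=> cplt s0.
have cauchy i j : vcauchy w (fun k => s k i j).
  move=> e e0; have [N HN] := s0 e e0; exists N.
  have half k d : (N <= k)%N -> w (s (k + d)%N i j - s k i j) < e.
    move=> Nk; elim: d => [|d IH]; first by rewrite addn0 subrr abs0.
    rewrite addnS -(subrKA (s (k + d)%N i j)) absD_lt //.
    have /mxabs_ltP := HN (k + d)%N (leq_trans Nk (leq_addr _ _)).
    by move=> /(_ e0 i j); rewrite !mxE.
  move=> a b Na Nb; have [le_ba|/ltnW le_ab] := leqP b a.
    by rewrite -(subnKC le_ba) half.
  by rewrite -(absN w) opprB -(subnKC le_ab) half.
have [l Hl] := choice (fun ij : 'I_m * 'I_n => cplt _ (cauchy ij.1 ij.2)).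
exists (\matrix_(i, j) l (i, j)); apply/mxlimP => e e0.
have cv (ij : 'I_m * 'I_n) : exists N, forall k, (N <= k)%N -> w (s k ij.1 ij.2 - l ij) < e.
  have /null_seqP h := Hl ij; apply: h => // k; exact: abs_ge0.
have [N HN] := choice cv; exists (\max_ij N ij) => k Nk.
apply/mxabs_ltP => // i j; rewrite !mxE.
by apply: (HN (i, j)); apply: leq_trans Nk; apply: leq_bigmax.
Qed.

End MatrixNorm.

Section FrobeniusPowers.
Context (F : finFieldType) (L : fieldType) (iota : {rmorphism {fraction {poly F}} -> L}).
Local Notation q := #|F|.

(** The argument [iota] witnesses that [L] has the characteristic of [F], on which additivity of the
    power map rests; carrying it lets the morphism instances be inferred. *)
Definition frobn (_ : {rmorphism {fraction {poly F}} -> L}) (i : nat) (x : L) : L :=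
  x ^+ (q ^ i).

Lemma frobn_zmod i : zmod_morphism (frobn iota i).
Proof.
move=> x y; rewrite /frobn exprDn_pchar ?pnatX ?pnat_card_pchar //; congr (_ + _).
apply/eqP; rewrite -addr_eq0 addrC -exprDn_pchar ?pnatX ?pnat_card_pchar //.
by rewrite subrr expr0n expn_eq0 -leqn0 leqNgt (ltnW (finNzRing_gt1 F)).
Qed.

Lemma frobn_monoid i : monoid_morphism (frobn iota i).
Proof. by split=> [|x y]; rewrite /frobn ?expr1n ?exprMn. Qed.

HB.instance Definition _ i := GRing.isZmodMorphism.Build L L (frobn iota i) (frobn_zmod i).
HB.instance Definition _ i := GRing.isMonoidMorphism.Build L L (frobn iota i) (frobn_monoid i).

Lemma qmapE i m n (A : 'M[L]_(m, n)) : qmap q i A = map_mx (frobn iota i) A.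
Proof. by []. Qed.

Lemma iter_frob i x : iter i (frob iota) x = x ^+ (q ^ i).
Proof. by elim: i => [|i /= ->]; rewrite ?expr1 // /frob -exprM expnSr. Qed.

End FrobeniusPowers.

Lemma qmap0n q (L : fieldType) m n (A : 'M[L]_(m, n)) : qmap q 0 A = A.
Proof. by apply/matrixP => a b; rewrite mxE expr1. Qed.

Lemma qmap_qmap q i k (L : fieldType) m n (A : 'M[L]_(m, n)) :
  qmap q i (qmap q k A) = qmap q (i + k) A.
Proof. by apply/matrixP => a b; rewrite !mxE -exprM -expnD addnC. Qed.

Lemma qmap_map q i (K L : fieldType) (j : {rmorphism K -> L}) m n (A : 'M[K]_(m, n)) :
  qmap q i (map_mx j A) = map_mx j (qmap q i A).
Proof. by apply/matrixP => a b; rewrite !mxE rmorphXn. Qed.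

Section QSeries.
Context (F : finFieldType) (K : fieldType) (iota : {rmorphism {fraction {poly F}} -> K}).
Context (C : fieldType) (j : {rmorphism K -> C}).
Local Notation q := #|F|.
Context (d : nat).
Implicit Types (P Q : qseries K d) (z : 'cV[C]_d).

Lemma qsumS P z n :
  qsum q j P z n.+1 = qsum q j P z n + map_mx j (P n) *m qmap q n z.
Proof. by rewrite /qsum big_ord_recr. Qed.

Lemma qsum_qcomp P Q z n :
  qsum q j (qcomp F P Q) z n
    = \sum_(i < n) map_mx j (P i) *m qmap q i (qsum q j Q z (n - i)).
Proof.
elim: n => [|n IH]; first by rewrite /qsum !big_ord0.
rewrite qsumS IH [RHS]big_ord_recr /= subSnn [qsum _ _ Q _ 1]qsumS [qsum _ _ _ _ 0]big_ord0 add0r.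
rewrite /qcomp rmorph_sum mulmx_suml big_ord_recr /= addrA; congr (_ + _); last first.
  by rewrite subnn map_mxM -qmap_map -mulmxA !qmap0n !(qmapE (j \o iota)) map_mxM.
rewrite -big_split; apply: eq_bigr => i _ /=.
rewrite subSn ?[(i <= n)%N]ltnW // qsumS !(qmapE (j \o iota)) map_mxD.
rewrite mulmxDr; congr (_ + _); rewrite -!(qmapE (j \o iota)) map_mxM -qmap_map -mulmxA.
rewrite !(qmapE (j \o iota)) map_mxM -!(qmapE (j \o iota)) qmap_qmap.
by rewrite subnKC // ltnW.
Qed.

Context (R : realType) (w : absval R C).

Lemma qcvg_null P z : qcvg w q j P z ->
  null_seq (fun n => mxabs w (map_mx j (P n) *m qmap q n z)).
Proof.
move=> [l /mxlimP ll] e e0; have [N HN] := ll e e0; exists N => n Nn.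
have -> : map_mx j (P n) *m qmap q n z
    = (qsum q j P z n.+1 - l) - (qsum q j P z n - l).
  by rewrite qsumS opprB addrA subrK addrAC addrN add0r.
by rewrite mxabsD_lt ?mxabsN ?HN // ltnW.
Qed.

Hypothesis w_complete : vcomplete w.

Lemma null_qcvg P z :
  null_seq (fun n => mxabs w (map_mx j (P n) *m qmap q n z)) -> qcvg w q j P z.
Proof.
move=> P0; apply: mx_series_cvg => //; apply: (null_seq_le (N := 0)) P0 => n _.
by rewrite qsumS addrAC addrN add0r.
Qed.

Lemma qevalP P z : qcvg w q j P z -> mxlim w (qsum q j P z) (qeval w q j P z).
Proof. exact: (@xgetPex _ 0 [set l | mxlim w (qsum q j P z) l]). Qed.

Lemma qeval_lim P z l : mxlim w (qsum q j P z) l -> qeval w q j P z = l.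
Proof. by move=> Hl; apply: mxlim_unique (qevalP (ex_intro _ l Hl)) Hl. Qed.

Lemma mxabs_qterm P z i b : mxabs w z <= b ->
  mxabs w (map_mx j (P i) *m qmap q i z) <= mxabs w (map_mx j (P i)) * b ^+ (q ^ i).
Proof.
move=> zb; rewrite (le_trans (mxabsM _ _ _)) // ler_wpM2l ?mxabs_ge0 //.
by rewrite (le_trans (mxabs_qmap _ _ _ _)) // lerXn2r ?nnegrE ?mxabs_ge0 //
  (le_trans _ zb) ?mxabs_ge0.
Qed.

(* No rearrangement is needed: the partial sums of the composite are
   [sum_i P_i (Q-partial sum up to n - i)^(i)] by [qsum_qcomp]. *)
Lemma qcomp_eval P Q z M : qcvg w q j Q z ->
    (forall n, mxabs w (map_mx j (Q n) *m qmap q n z) <= M) ->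
    null_seq (fun i => mxabs w (map_mx j (P i)) * M ^+ (q ^ i)) ->
  exists l, mxlim w (qsum q j P (qeval w q j Q z)) l
    /\ mxlim w (qsum q j (qcomp F P Q) z) l.
Proof.
move=> cvQ QM PM; set y := qeval w q j Q z.
have M0 : 0 <= M by apply: le_trans (QM 0%N); apply: mxabs_ge0.
have limQ : mxlim w (qsum q j Q z) y := qevalP cvQ.
have sumM n : mxabs w (qsum q j Q z n) <= M by apply: mxabs_sum_le.
have yM : mxabs w y <= M by apply: mxlim_bound limQ sumM.
have [l Hl] : qcvg w q j P y.
  by apply: null_qcvg; apply: (null_seq_le (N := 0)) PM => i _; apply: mxabs_qterm.
exists l; split=> //; apply: eq_mxlim Hl => e e0.
have [I HI] := PM e e0.
(* For i < I the coefficients have a common bound [c] and the error of the inner partial sum must be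
   small; for i >= I the term is small for any error up to [M]. *)
have [c c0 Hc] : exists2 c, 0 < c & forall i, (i < I)%N -> mxabs w (map_mx j (P i)) <= c.
  exists (1 + \sum_(i < I) mxabs w (map_mx j (P i))).
    by rewrite ltr_pwDl // sumr_ge0 // => i _; apply: mxabs_ge0.
  move=> i ltI; rewrite (bigD1 (Ordinal ltI)) //= addrCA lerDl.
  by rewrite addr_ge0 // sumr_ge0 // => k _; apply: mxabs_ge0.
(* The bound 1 keeps the q^i-th power of the error below the error itself. *)
have /mxlimP/(_ (Num.min 1 (e / c))) [|N HN] := limQ; first by rewrite lt_min ltr01 divr_gt0.
exists (N + I)%N => n NIn; rewrite qsum_qcomp /qsum -sumrB.
apply: mxabs_sum_lt => // i _; rewrite -mulmxBr !(qmapE (j \o iota)) -map_mxB -(qmapE (j \o iota)).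
set D := y - _; have [ltI|leI] := ltnP i I; last first.
  apply: le_lt_trans (HI i leI); apply: mxabs_qterm.
  by rewrite /D mxabsB_le // sumM.
have : mxabs w D < Num.min 1 (e / c).
  by rewrite -mxabsN opprB; apply: HN; lia.
rewrite lt_min ltr_pdivlMr // mulrC => /andP[D1 De].
apply: le_lt_trans De; apply: (le_trans (mxabs_qterm _ _ (lexx _))).
rewrite ler_pM ?exprn_ge0 ?mxabs_ge0 ?Hc // -[leRHS]expr1.
by rewrite ler_wiXn2l ?mxabs_ge0 ?(ltW D1) // expn_gt0 ltnW ?finNzRing_gt1.
Qed.

End QSeries.

(** * Twisted series and the action of twisted polynomials *)

(** The entries of [tab n] below [n] are final: later tables keep them, and locality of [Phi] makes
    them satisfy the recursion. *)
Lemma strong_recursion (T : Type) (x0 : T) (Phi : nat -> (nat -> T) -> T) :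
    (forall n f g, (forall i, (i < n)%N -> f i = g i) -> Phi n f = Phi n g) ->
  exists f, forall n, f n = Phi n f.
Proof.
move=> loc.
pose tab := fix tab n := if n is n'.+1 then
  fun k => if k == n' then Phi n' (tab n') else tab n' k else fun=> x0.
have stable n k : (k < n)%N -> tab n k = tab k.+1 k.
  elim: n => // n IH; rewrite ltnS leq_eqVlt => /orP[/eqP -> //|lt_kn].
  by rewrite [LHS]/= ltn_eqF // IH.
exists (fun n => tab n.+1 n) => n /=; rewrite eqxx; apply: loc => i lt_in.
exact: stable.
Qed.

Section QComp.
Context (F : finFieldType) (K : fieldType) (iota : {rmorphism {fraction {poly F}} -> K}).
Context (d : nat).
Local Notation q := #|F|.
Local Notation S := (skewpoly (frob iota)).
Implicit Types (P Q : qseries K d) (A B : 'M[S]_d).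

Lemma qcompA P Q T : qcomp F (qcomp F P Q) T = qcomp F P (qcomp F Q T).
Proof.
apply/funext => n; rewrite /qcomp.
pose E j i := P j *m (qmap q j (Q (i - j)%N) *m qmap q i (T (n - i)%N)).
symmetry; transitivity (\sum_(j < n.+1) \sum_(i < n.+1 | (j <= i)%N) E j i).
  apply: eq_bigr => j _; rewrite (qmapE iota) raddf_sum mulmx_sumr.
  rewrite -(big_mkord (fun i => (j <= i)%N) (E j)).
  have le_jn : (j <= n.+1)%N := ltnW (ltn_ord j).
  rewrite (big_cat_nat (leq0n j) le_jn) //= [X in _ = X + _]big_nat_cond.
  rewrite [X in _ = X + _]big_pred0 ?add0r; last first.
    by move=> i; case: (leqP j i) => // le_ji; rewrite andbF.
  transitivity (\sum_(0 + j <= i < n.+1 | (j <= i)%N) E j i) => //.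
  rewrite big_addn subSn ?leq_ord // big_mkord.
  apply: eq_big => [k|k _]; first by rewrite leq_addl.
  by rewrite /E addnK [(k + j)%N]addnC subnDA map_mxM -!(qmapE iota) qmap_qmap.
rewrite (exchange_big_dep predT) //=; apply: eq_bigr => i _.
rewrite (big_ord_narrow_leq (leq_ord i)) mulmx_suml /=.
by apply: eq_bigr => j _; rewrite /E mulmxA.
Qed.

Lemma qcomp_constl (M : 'M[K]_d) Q n : qcomp F (qconst M) Q n = M *m Q n.
Proof.
rewrite /qcomp big_ord_recl /= subn0 qmap0n big1 ?addr0 // => i _.
by rewrite mul0mx.
Qed.

Lemma qcomp_constr P (M : 'M[K]_d) n : qcomp F P (qconst M) n = P n *m qmap q n M.
Proof.
rewrite /qcomp big_ord_recr /= subnn big1 ?add0r // => i _.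
case e: (n - i)%N => [|k] /=; last by rewrite (qmapE iota) raddf0 mulmx0.
by have := ltn_ord i; rewrite -subn_gt0 e.
Qed.

Lemma qid_const : qid K d = qconst 1%:M.
Proof. by apply/funext => -[]. Qed.

Lemma qcomp1 P : qcomp F (qid K d) P = P.
Proof. by apply/funext => n; rewrite qid_const qcomp_constl mul1mx. Qed.

Lemma qcompr1 P : qcomp F P (qid K d) = P.
Proof. by apply/funext => n; rewrite qid_const qcomp_constr (qmapE iota) map_mx1 mulmx1. Qed.

Lemma qcompDl P P' Q : qcomp F (fun n => P n + P' n) Q
  = fun n => qcomp F P Q n + qcomp F P' Q n.
Proof.
by apply/funext => n; rewrite /qcomp -big_split; apply: eq_bigr => i _; rewrite mulmxDl.
Qed.

Lemma qcompDr P Q Q' : qcomp F P (fun n => Q n + Q' n)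
  = fun n => qcomp F P Q n + qcomp F P Q' n.
Proof.
apply/funext => n; rewrite /qcomp -big_split; apply: eq_bigr => i _.
by rewrite (qmapE iota) map_mxD mulmxDr.
Qed.

(** A right inverse is found coefficient by coefficient. It has a right inverse of its own, which
    associativity identifies with [P], so it is two-sided. *)
Lemma qinverse P : P 0%N = 1%:M ->
  exists2 Q, qcomp F P Q = qid K d & qcomp F Q P = qid K d.
Proof.
have right_inv P' : P' 0%N = 1%:M -> exists2 Q, qcomp F P' Q = qid K d & Q 0%N = 1%:M.
  move=> P0; pose Phi n (f : qseries K d) : 'M[K]_d :=
    qid K d n - \sum_(i < n) P' i.+1 *m qmap q i.+1 (f (n - i.+1)%N).
  have [n f g e|Q HQ] := @strong_recursion _ 0 Phi.
    rewrite /Phi; congr (_ - _); apply: eq_bigr => i _; rewrite e //.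
    by rewrite ltn_subrL (leq_ltn_trans _ (ltn_ord i)).
  exists Q; last by rewrite HQ /Phi big_ord0 subr0.
  apply/funext => n; rewrite /qcomp big_ord_recl P0 mul1mx subn0 qmap0n HQ /Phi.
  by rewrite subrK.
move=> P0; have [Q PQ Q0] := right_inv P P0; exists Q => //.
have [P' QP' _] := right_inv Q Q0.
by rewrite -[in LHS](qcompr1 P) -QP' -(qcompA P) PQ qcomp1.
Qed.

Lemma tcoefD A B : tcoef (A + B) = fun n => tcoef A n + tcoef B n.
Proof. by apply/funext => n; apply/matrixP => a b; rewrite !mxE coefD. Qed.

Lemma tcoefM A B : tcoef (A * B) = qcomp F (tcoef A) (tcoef B).
Proof.
apply/funext => n; apply/matrixP => a b; rewrite /qcomp summxE !mxE.
have coef_sumS (I : Type) (l : seq I) (G : I -> S) :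
    (\sum_(i <- l) G i : {poly K})`_n = \sum_(i <- l) (G i : {poly K})`_n.
  by elim/big_rec2: _ => [|i x y _ <-]; rewrite ?coef0 ?coefD.
rewrite coef_sumS; under [RHS]eq_bigr do rewrite mxE.
rewrite exchange_big /=; apply: eq_bigr => k _; rewrite coef_skew_mul.
by apply: eq_bigr => i _; rewrite !mxE iter_frob.
Qed.

Lemma tcoefC (M : 'M[K]_d) : tcoef (map_mx (@skewC K (frob iota)) M) = qconst M.
Proof.
by apply/funext => -[|n]; apply/matrixP => a b; rewrite !mxE coefC.
Qed.

Lemma dpartM A B : dpart (A * B) = dpart A *m dpart B.
Proof. by rewrite /dpart tcoefM /qcomp big_ord1 qmap0n. Qed.

Lemma dpartD A B : dpart (A + B) = dpart A + dpart B.
Proof. by rewrite /dpart tcoefD. Qed.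

Lemma qconstM (M N : 'M[K]_d) : qconst (M *m N) = qcomp F (qconst M) (qconst N).
Proof.
by apply/funext => -[|n]; rewrite qcomp_constl //= mulmx0.
Qed.

Lemma tcoef_Fscal c : tcoef (Fscal iota d c) = qconst (kconst iota c)%:M.
Proof.
apply/funext => -[|n]; apply/matrixP => a b; rewrite !mxE.
  by case: (a == b); rewrite ?mulr0n ?mulr1n ?coef0 ?coefC.
by case: (a == b); rewrite ?mulr0n ?mulr1n ?coef0 ?coefC.
Qed.

(** The functional equation of the exponential for one operator. It is stable under sums and
    products and holds for the constants, so for a t-module it is checked at [G 'X] alone. *)
Definition qcommutes P A := qcomp F P (qconst (dpart A)) = qcomp F (tcoef A) P.

Lemma qcommutesD P A B : qcommutes P A -> qcommutes P B -> qcommutes P (A + B).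
Proof.
rewrite /qcommutes tcoefD qcompDl => <- <-; rewrite dpartD -qcompDr; congr qcomp.
by apply/funext => -[|n] //=; rewrite addr0.
Qed.

Lemma qcommutesM P A B : qcommutes P A -> qcommutes P B -> qcommutes P (A * B).
Proof.
rewrite /qcommutes => PA PB.
by rewrite tcoefM qcompA -PB -qcompA -PA qcompA dpartM qconstM.
Qed.

Lemma qcommutes_Fscal P c : qcommutes P (Fscal iota d c).
Proof.
rewrite /qcommutes /dpart tcoef_Fscal; apply/funext => n /=.
rewrite qcomp_constl qcomp_constr.
have -> : qmap q n (kconst iota c)%:M = (kconst iota c)%:M :> 'M[K]_d.
  rewrite (qmapE iota) map_scalar_mx; congr _%:M.
  by rewrite /= /frobn -(iter_frob iota); elim: n => //= n ->; rewrite frob_kconst.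
by rewrite scalar_mxC.
Qed.

Lemma tmodule_poly_ind (G : tmodule iota d) (Q : 'M[S]_d -> Prop) :
    Q (G 'X) -> (forall c, Q (Fscal iota d c)) ->
    (forall A B, Q A -> Q B -> Q (A + B)) -> (forall A B, Q A -> Q B -> Q (A * B)) ->
  forall a, Q (G a).
Proof.
move=> QX QC QD QM; have GC c : G c%:P = Fscal iota d c.
  by rewrite -[c%:P]mulr1 mul_polyC tact_linear rmorph1 mulr1.
elim/poly_ind => [|a c IH]; first by rewrite -[0]/(0%:P) GC.
by rewrite rmorphD rmorphM GC; apply: QD => //; apply: QM.
Qed.

Lemma is_expP (G : tmodule iota d) P : P 0%N = 1%:M -> qcommutes P (G 'X) -> is_exp G P.
Proof.
move=> P0 PX; split=> //; apply: (tmodule_poly_ind (Q := qcommutes P)) => //.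
- exact: qcommutes_Fscal.
- exact: qcommutesD.
- exact: qcommutesM.
Qed.

Lemma log_seriesP (G : tmodule iota d) : is_exp G (exp_series G) ->
  qcomp F (exp_series G) (log_series G) = qid K d /\
  qcomp F (log_series G) (exp_series G) = qid K d.
Proof.
move=> [E0 _]; have [L EL LE] := qinverse E0.
exact: (@xgetPex _ (fun=> 0) [set P | qcomp F (exp_series G) P = qid K d /\
  qcomp F P (exp_series G) = qid K d] (ex_intro _ L (conj EL LE))).
Qed.

(** log [a] = log [a] exp log = log exp ∂[a] log = ∂[a] log. *)
Lemma log_series_comm (G : tmodule iota d) a : is_exp G (exp_series G) ->
  qcomp F (log_series G) (tcoef (G a)) = qcomp F (qconst (dpart (G a))) (log_series G).
Proof.
move=> expG; have [EL LE] := log_seriesP expG.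
rewrite -[LHS]qcompr1 -EL -qcompA [qcomp F (qcomp _ _ _) (exp_series G)]qcompA.
by rewrite -(proj2 expG a) -qcompA LE qcomp1.
Qed.

End QComp.

Section TApp.
Context (F : finFieldType) (K : fieldType) (iota : {rmorphism {fraction {poly F}} -> K}).
Context (L : fieldType) (j : {rmorphism K -> L}) (d : nat).
Local Notation q := #|F|.
Local Notation S := (skewpoly (frob iota)).
Implicit Types (A B : 'M[S]_d) (z : 'cV[L]_d).

(** Operators become finitely supported series, so that results on composing and evaluating series
    also cover the t-module action; [N] is uniform in [z]. *)
Lemma tapp_qsum A : exists N, (forall i, (N <= i)%N -> tcoef A i = 0) /\
  forall z n, (N <= n)%N -> qsum q j (tcoef A) z n = tapp j A z.
Proof.
pose N := \max_a \max_b size (A a b : {poly K}).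
have leN a b : (size (A a b : {poly K}) <= N)%N.
  by rewrite (leq_trans _ (leq_bigmax a)) // (leq_bigmax b).
exists N; split=> [i Ni|z n Nn].
  by apply/matrixP => a b; rewrite !mxE nth_default // (leq_trans (leN a b)).
apply/matrixP => a c; rewrite /qsum summxE [RHS]mxE.
transitivity (\sum_(i < n) \sum_b j (tcoef A i a b) * z b c ^+ (q ^ i)).
  by apply: eq_bigr => i _; rewrite mxE; apply: eq_bigr => b _; rewrite !mxE.
rewrite exchange_big /=; apply: eq_bigr => b _.
rewrite (big_ord_widen n (fun i => j (A a b : {poly K})`_i * z b 0 ^+ (q ^ i))); last first.
  exact: leq_trans Nn.
rewrite [RHS]big_mkcond; apply: eq_bigr => i _; rewrite !mxE [c]ord1.
by case: ltnP => // le_i; rewrite nth_default // rmorph0 mul0r.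
Qed.

Lemma tappM A B z : tapp j (A * B) z = tapp j A (tapp j B z).
Proof.
have [N [_ HN]] := tapp_qsum (A * B); have [NA [A0 HA]] := tapp_qsum A.
have [NB [_ HB]] := tapp_qsum B.
(* For i < NA, the n - i terms left to [B] still exhaust it. *)
pose n := (N + NA + NB)%N.
rewrite -(HN z n) ?tcoefM ?(qsum_qcomp iota) -?(HA _ n); try by rewrite /n; lia.
apply: eq_bigr => i _; have [lt_i|le_i] := ltnP i NA.
  by congr (_ *m qmap _ _ _); apply: HB; move: (nat_of_ord i) lt_i => k; rewrite /n; lia.
by rewrite A0 // map_mx0 !mul0mx.
Qed.

Lemma tappD A B z : tapp j (A + B) z = tapp j A z + tapp j B z.
Proof.
have [N [_ HN]] := tapp_qsum (A + B); have [NA [_ HA]] := tapp_qsum A.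
have [NB [_ HB]] := tapp_qsum B.
pose n := (N + NA + NB)%N.
rewrite -(HN z n) -?(HA z n) -?(HB z n); try by rewrite /n; lia.
by rewrite -big_split tcoefD; apply: eq_bigr => i _; rewrite map_mxD mulmxDl.
Qed.

Lemma tapp_Fscal c z : tapp j (Fscal iota d c) z = j (kconst iota c) *: z.
Proof.
have [N [_ HN]] := tapp_qsum (Fscal iota d c).
rewrite -(HN z N.+1) // /qsum big_ord_recl tcoef_Fscal /= qmap0n map_scalar_mx.
by rewrite mul_scalar_mx big1 ?addr0 // => i _; rewrite map_mx0 mul0mx.
Qed.

Lemma tapp1 z : tapp j (1 : 'M[S]_d) z = z.
Proof. by rewrite -(Fscal1 iota d) tapp_Fscal /kconst !rmorph1 scale1r. Qed.

End TApp.

Lemma map_tapp (F : finFieldType) (K L L' : fieldType)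
    (iota : {rmorphism {fraction {poly F}} -> K}) (j : {rmorphism K -> L})
    (h : {rmorphism L -> L'}) d (A : 'M[skewpoly (frob iota)]_d) z :
  map_mx h (tapp j A z) = tapp (h \o j) A (map_mx h z).
Proof.
apply/matrixP => a b; rewrite !mxE rmorph_sum; apply: eq_bigr => k _.
by rewrite rmorph_sum; apply: eq_bigr => i _; rewrite !mxE rmorphM rmorphXn.
Qed.

(** * Exponential and logarithm of [Gsu] *)

Section AdNilpotent.
Context (K : fieldType) (d : nat) (N : 'M[K]_d).

Definition mxad (X : 'M[K]_d) : 'M[K]_d := N * X - X * N.

Lemma mxadB X X' : mxad (X - X') = mxad X - mxad X'.
Proof.
by rewrite /mxad mulrBr mulrBl !opprB addrACA [RHS]addrACA [- (X * N) + _]addrC.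
Qed.

Lemma mxadD X X' : mxad (X + X') = mxad X + mxad X'.
Proof. by rewrite /mxad mulrDr mulrDl opprD addrACA. Qed.

Lemma mxadZ c X : mxad (c *: X) = c *: mxad X.
Proof.
by rewrite /mxad scalerBr; congr (_ - _); apply/esym; [apply: scalemxAr | apply: scalemxAl].
Qed.

(** The invariant [small j Y] says that N^a Y N^b vanishes for a + b >= j. It holds for X at j = 2M,
    where one exponent is at least M; each [mxad] lowers j by one, and j = 0 gives Y = 0. *)
Lemma mxad_nilpotent M : N ^+ M = 0 -> forall X, iter (M + M) mxad X = 0.
Proof.
move=> N0 X; pose small j Y := forall a b, (j <= a + b)%N -> N ^+ a * Y * N ^+ b = 0.
have NM a : (M <= a)%N -> N ^+ a = 0.
  by move=> le_a; rewrite -(subnKC le_a) exprD N0 mul0r.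
have smallX : small (M + M)%N X.
  move=> a b le_ab; have [le_a|lt_a] := leqP M a; first by rewrite NM // !mul0r.
  by rewrite (NM b) ?mulr0 //; lia.
have smallS j Y : small j.+1 Y -> small j (mxad Y).
  move=> sY a b le_ab; rewrite /mxad mulrBr mulrBl !mulrA -exprSr -[_ * N * _]mulrA -exprS.
  by rewrite !sY ?subrr // ?addnS.
have smallI i : (i <= M + M)%N -> small (M + M - i)%N (iter i mxad X).
  elim: i => [|i IH] le_i; first by rewrite subn0.
  by apply: smallS; rewrite subnSK //; apply: IH; apply: ltnW.
have := smallI (M + M)%N (leqnn _) 0%N 0%N; rewrite subnn => /(_ isT).
by rewrite expr0 mul1r mulr1.
Qed.

(** The Neumann series of (del - ad N)^-1 breaks off because ad N is nilpotent; [step n] is its n-th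
    partial sum with remainder. *)
Lemma mxad_solve M (del : K) : N ^+ M = 0 -> del != 0 ->
  forall Y, exists X, del *: X - mxad X = Y.
Proof.
move=> N0 del0 Y; pose m := (M + M)%N.
have step n : exists X, del *: X - mxad X = Y - del ^- n *: iter n mxad Y.
  elim: n => [|n [X IH]].
    by exists 0; rewrite expr0 invr1 scale1r subrr /mxad mul0r mulr0 subrr scaler0 subr0.
  exists (X + del ^- n.+1 *: iter n mxad Y).
  rewrite scalerDr mxadD mxadZ opprD addrACA IH scalerA exprS invfM mulrA mulfV // mul1r.
  by rewrite addrA subrK.
by have [X HX] := step m; exists X; rewrite HX mxad_nilpotent // scaler0 subr0.
Qed.

Context (R : realType) (C : fieldType) (w : absval R C) (j : {rmorphism K -> C}).
Local Notation nrm X := (mxabs w (map_mx j X)).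
Hypothesis N_le1 : nrm N <= 1.

Lemma mxad_le X : nrm (mxad X) <= nrm X.
Proof.
rewrite /mxad map_mxB; apply: mxabsB_le; rewrite map_mxM (le_trans (mxabsM _ _ _)) //.
  by rewrite ler_piMl ?mxabs_ge0.
by rewrite ler_piMr ?mxabs_ge0.
Qed.

Lemma mxad_iter_le n X : nrm (iter n mxad X) <= nrm X.
Proof. by elim: n => //= n; apply: le_trans (mxad_le _). Qed.

(** As |ad N| <= 1 < |del|, the term [del *: X] dominates [mxad X] and must be balanced by [Y]. *)
Lemma mxad_bound_large del X Y : 1 < w (j del) -> del *: X - mxad X = Y ->
  w (j del) * nrm X <= nrm Y.
Proof.
move=> del1 eqY; have [le_XY|lt_YX] := leP (w (j del) * nrm X) (nrm Y) => //.
have : w (j del) * nrm X <= Num.max (nrm Y) (nrm X).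
  rewrite -mxabsZ -map_mxZ -(subrK (mxad X) (del *: X)) eqY map_mxD.
  by rewrite (le_trans (mxabsD _ _ _)) // ge_max !le_max lexx (mxad_le X) orbT.
rewrite le_max leNgt lt_YX /= => leX.
have [X0|Xn0] := eqVneq (nrm X) 0; first by move: lt_YX; rewrite X0 mulr0 ltNge mxabs_ge0.
have Xpos : 0 < nrm X by rewrite lt_neqAle eq_sym Xn0 mxabs_ge0.
by move: leX; rewrite -ler_pdivlMr // divff // leNgt del1.
Qed.

(** Here |del| may be below 1 and ad N may dominate. Applying ad^n to the equation gives c |ad^n X|
    <= max(|Y|, |ad^(n+1) X|); the chain ends at ad^(2M) = 0 and costs c^(2M). *)
Lemma mxad_bound_small M del X Y c : N ^+ M = 0 -> 0 < c <= 1 -> c <= w (j del) ->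
  del *: X - mxad X = Y -> c ^+ (M + M) * nrm X <= nrm Y.
Proof.
move=> N0 /andP[c0 c1] c_del eqY.
have eq_n n : del *: iter n mxad X - iter n.+1 mxad X = iter n mxad Y.
  by elim: n => [|n IH]; rewrite ?eqY // !iterS -IH [RHS]mxadB [X in _ = X - _]mxadZ.
have step n : c * nrm (iter n mxad X) <= Num.max (nrm Y) (nrm (iter n.+1 mxad X)).
  apply: (@le_trans _ _ (w (j del) * nrm (iter n mxad X))).
    by rewrite ler_wpM2r ?mxabs_ge0.
  rewrite -mxabsZ -map_mxZ -(subrK (iter n.+1 mxad X) (del *: _)) eq_n map_mxD.
  by rewrite (le_trans (mxabsD _ _ _)) // ge_max !le_max lexx (mxad_iter_le n Y) orbT.
have all_n n : c ^+ n * nrm X <= Num.max (nrm Y) (nrm (iter n mxad X)).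
  elim: n => [|n IH]; first by rewrite expr0 mul1r le_max lexx orbT.
  rewrite exprS -mulrA (@le_trans _ _ (c * Num.max (nrm Y) (nrm (iter n mxad X)))) //.
    by rewrite ler_pM2l.
  rewrite maxr_pMr ?(ltW c0) // ge_max step andbT le_max.
  by rewrite ler_piMl // mxabs_ge0.
rewrite (le_trans (all_n _)) // mxad_nilpotent // map_mx0 mxabs0 ge_max lexx.
exact: mxabs_ge0.
Qed.

End AdNilpotent.

Section Evaluation.
Context (F : finFieldType) (K : fieldType) (iota : {rmorphism {fraction {poly F}} -> K}).

Lemma kconst_zmod : zmod_morphism (kconst iota).
Proof. by move=> x y; rewrite /kconst !rmorphB. Qed.

Lemma kconst_monoid : monoid_morphism (kconst iota).
Proof. by split=> [|x y]; rewrite /kconst ?rmorph1 // !rmorphM. Qed.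

HB.instance Definition _ := GRing.isZmodMorphism.Build F K (kconst iota) kconst_zmod.
HB.instance Definition _ := GRing.isMonoidMorphism.Build F K (kconst iota) kconst_monoid.

Definition thetaev (iota : {rmorphism {fraction {poly F}} -> K}) (a : {poly F}) : K :=
  iota (FracField.tofrac a).

Lemma thetaev_zmod : zmod_morphism (thetaev iota).
Proof. by move=> x y; rewrite /thetaev !rmorphB. Qed.

Lemma thetaev_monoid : monoid_morphism (thetaev iota).
Proof. by split=> [|x y]; rewrite /thetaev ?rmorph1 // !rmorphM. Qed.

HB.instance Definition _ := GRing.isZmodMorphism.Build {poly F} K (thetaev iota) thetaev_zmod.
HB.instance Definition _ :=
  GRing.isMonoidMorphism.Build {poly F} K (thetaev iota) thetaev_monoid.

Lemma thetaevX : thetaev iota 'X = theta iota. Proof. by []. Qed.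

Lemma thetaevE a : thetaev iota a = (map_poly (kconst iota) a).[theta iota].
Proof.
elim/poly_ind: a => [|a c IH]; first by rewrite !rmorph0 horner0.
by rewrite !rmorphD !rmorphM /= map_polyX map_polyC !hornerE -IH thetaevX.
Qed.

Lemma thetaev_eq0 a : (thetaev iota a == 0) = (a == 0).
Proof. by rewrite /thetaev fmorph_eq0 tofrac_eq0. Qed.

Lemma theta_frob_neq n : theta iota ^+ (#|F| ^ n.+1) - theta iota != 0.
Proof.
rewrite -thetaevX -rmorphXn -rmorphB thetaev_eq0 subr_eq0.
apply/eqP => /(congr1 (fun p : {poly F} => size p)).
rewrite size_polyXn size_polyX => -[e].
have := ltn_expl n.+1 (finNzRing_gt1 F); rewrite e; lia.
Qed.

(** A q^e-th power beyond the nilpotency order turns ∂[t] into a scalar, and a^(q^e) is a polynomial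
    in t^(q^e); hence one exponent serves every [a]. *)
Lemma dpart_pow d (G : tmodule iota d) : exists e, forall a,
  dpart (G a) ^+ (#|F| ^ e) = (thetaev iota a ^+ (#|F| ^ e))%:M.
Proof.
case: d G => [|d] G; first by exists 0%N => a; rewrite [LHS]flatmx0 [RHS]flatmx0.
have [n Dn] := tact_nilpotent G; exists n.
have qn : ([pchar K]%R).-nat (#|F| ^ n)%N by rewrite pnatX pnat_card_pchar.
have pF : ([pchar F]%R).-nat #|F|.
  have [p p_pr pF] := finPcharP F.
  have /abelian.abelem_pgroup := abelian.fin_ring_pchar_abelem pF.
  by rewrite /pgroup.pgroup cardsT; apply: sub_in_pnat => q _ /eqP ->.
have dX m a : dpart (G (a ^+ m)) = dpart (G a) ^+ m.
  elim: m => [|m IH]; last by rewrite !exprS rmorphM dpartM IH.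
  by rewrite !expr0 rmorph1 -(Fscal1 iota) /dpart tcoef_Fscal /= /kconst !rmorph1.
have DX : dpart (G 'X) ^+ (#|F| ^ n) = (theta iota ^+ (#|F| ^ n))%:M.
  set D := dpart _; have le_n : (n <= #|F| ^ n)%N by rewrite ltnW // ltn_expl // finNzRing_gt1.
  have Dq : (D - (theta iota)%:M) ^+ (#|F| ^ n) = 0.
    by rewrite -(subnKC le_n) exprD Dn mul0r.
  (* Additivity of the power map needs commutativity, so the identity is proved for polynomials and
     then evaluated at [D]. *)
  have : ('X - (theta iota)%:P) ^+ (#|F| ^ n)
      = 'X ^+ (#|F| ^ n) - (theta iota ^+ (#|F| ^ n))%:P.
    have qP : ([pchar {poly K}]%R).-nat (#|F| ^ n)%N.
      by apply: sub_in_pnat qn => p _; rewrite pchar_poly.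
    by rewrite exprDn_pchar // exprNn_pchar // rmorphXn.
  move=> /(congr1 (horner_mx D)).
  rewrite rmorphXn !rmorphB /= rmorphXn /= horner_mx_X !horner_mx_C Dq => /esym/eqP.
  by rewrite subr_eq0 => /eqP.
have dC c : dpart (G c%:P) = (kconst iota c)%:M.
  by rewrite -[c%:P]mulr1 mul_polyC tact_linear rmorph1 mulr1 /dpart tcoef_Fscal.
move=> a; rewrite -dX -rmorphXn.
elim/poly_ind: a => [|a c IH].
  by rewrite expr0n expn_eq0 -leqn0 leqNgt (ltnW (finNzRing_gt1 F)) -[_%:R]/(0%:P) dC.
have qP : ([pchar {poly F}]%R).-nat (#|F| ^ n)%N.
  by rewrite pnatX; apply/orP; left; apply: sub_in_pnat pF => p _; rewrite pchar_poly.
rewrite exprDn_pchar // exprMn !rmorphD !rmorphM dpartD dpartM IH dX DX.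
congr (_ *m _ + _); first by rewrite /= -thetaevX -rmorphXn.
by rewrite -polyC_exp dC.
Qed.

End Evaluation.

Section GsuSeries.
Context (F : finFieldType) (K : fieldType) (iota : {rmorphism {fraction {poly F}} -> K}).
Context (r : nat) (s : 'I_r -> nat) (u : 'I_r -> K).
Local Notation q := #|F|.
Local Notation G := (Gsu iota s u).
Local Notation d := (Gdim s).
Local Notation N := (Gnil K s).
Local Notation T := (Gtau s u).
Local Notation th := (theta iota).
Local Notation E := (exp_series G).
Local Notation L := (log_series G).

Lemma q_gt1 : (1 < q)%N. Proof. exact: finNzRing_gt1. Qed.
Lemma q_gt0 n : (0 < q ^ n)%N. Proof. by rewrite expn_gt0 ltnW ?q_gt1. Qed.

Lemma tcoef_Gsu n : tcoef (G 'X) n = if n is n'.+1 then (if n' is 0 then T else 0) else th%:M + N.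
Proof.
rewrite [G 'X]poly_act_X tcoefD tcoefC.
have -> : tcoef (map_mx (fun c => skewC (frob iota) c * tau (frob iota)) T) n
    = if n is 1 then T else 0.
  move: T => M; apply/matrixP => a b.
  rewrite !mxE coef_skew_mul big_ord_recl coefC subn0 coefX big1 ?addr0.
    by case: n => [|[|n]] /=; rewrite ?mulr0 ?mulr1 ?mxE.
  by move=> i _; rewrite coefC mul0r.
by case: n => [|[|n]] /=; rewrite ?addr0 ?add0r.
Qed.

Lemma qmap_dpart_Gsu n : qmap q n (th%:M + N) = (th ^+ (q ^ n))%:M + N.
Proof.
rewrite (qmapE iota) map_mxD map_scalar_mx /= /frobn; congr (_ + _).
apply/matrixP => i k; rewrite !mxE; case: (_ && _) => /=; rewrite ?expr1n //.
by rewrite expr0n eqn0Ngt q_gt0.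
Qed.

Definition thetadiff n : K := th ^+ (q ^ n) - th.

(** The coefficient of tau^(n+1) in the functional equation at t. The entries of N are 0 and 1, so
    Frobenius fixes N and its two occurrences form the commutator. *)
Lemma exp_recurrence P n : qcommutes P (G 'X) ->
  thetadiff n.+1 *: P n.+1 - mxad N (P n.+1) = T *m qmap q 1 (P n).
Proof.
move/(congr1 (fun Q => Q n.+1)); rewrite (qcomp_constr iota) /dpart tcoef_Gsu qmap_dpart_Gsu.
rewrite /qcomp 2!big_ord_recl big1 ?addr0 => [|i _]; last first.
  by rewrite tcoef_Gsu mul0mx.
rewrite !tcoef_Gsu /= subn0 subSS subn0 qmap0n mulmxDr mulmxDl mul_mx_scalar mul_scalar_mx.
move=> eqP; apply: (addrI (th *: P n.+1 + N *m P n.+1)); rewrite -eqP /mxad.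
rewrite -[_ * N]/(_ *m N) -[N * _]/(N *m _) opprB scalerBl.
by rewrite addrACA ![_ + (_ - _)]addrC !subrK.
Qed.

Lemma qcommutes_Gsu P : P 0%N = 1%:M ->
    (forall n, thetadiff n.+1 *: P n.+1 - mxad N (P n.+1) = T *m qmap q 1 (P n)) ->
  qcommutes P (G 'X).
Proof.
move=> P0 recP; apply/funext => -[|n].
  by rewrite (qcomp_constr iota) /qcomp big_ord1 P0 !qmap0n mul1mx mulmx1.
rewrite (qcomp_constr iota) /dpart tcoef_Gsu qmap_dpart_Gsu.
rewrite /qcomp 2!big_ord_recl big1 ?addr0 => [|i _]; last first.
  by rewrite tcoef_Gsu mul0mx.
rewrite !tcoef_Gsu /= subn0 subSS subn0 qmap0n mulmxDr mulmxDl mul_mx_scalar mul_scalar_mx.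
rewrite -recP /mxad -[_ * N]/(_ *m N) -[N * _]/(N *m _) opprB scalerBl.
by rewrite addrACA ![_ + (_ - _)]addrC !subrK.
Qed.

(** [exp_series] is picked by [xget], so existence suffices: each step of the recurrence is solvable
    because theta^(q^n) differs from theta and ad N is nilpotent. *)
Lemma exp_seriesP : is_exp G E.
Proof.
suff [P [P0 PX]] : exists P : qseries K d, P 0%N = 1%:M /\ qcommutes P (G 'X).
  by apply: (@xgetPex _ (fun=> 0) [set P | is_exp G P]); exists P; apply: is_expP.
have solve (nX : nat * 'M[K]_d) : exists Y : 'M[K]_d,
    thetadiff nX.1.+1 *: Y - mxad N Y = T *m qmap q 1 nX.2.
  exact: mxad_solve (Gnil_nilpotent K s) (theta_frob_neq iota _) _.
have [f Hf] := choice solve.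
pose P : qseries K d := fix P n := if n is n'.+1 then f (n', P n') else 1%:M.
exists P; split=> //; apply: qcommutes_Gsu => // n.
exact: Hf (n, P n).
Qed.

Lemma exp0 : E 0%N = 1%:M.
Proof. by have [] := exp_seriesP. Qed.

Lemma exp_rec n : thetadiff n.+1 *: E n.+1 - mxad N (E n.+1) = T *m qmap q 1 (E n).
Proof.
by apply: exp_recurrence; apply: (proj2 exp_seriesP).
Qed.

Lemma log_expK : qcomp F L E = qid K d.
Proof. by have [] := log_seriesP exp_seriesP. Qed.

Lemma exp_logK : qcomp F E L = qid K d.
Proof. by have [] := log_seriesP exp_seriesP. Qed.

Lemma log0 : L 0%N = 1%:M.
Proof.
by have := congr1 (fun P => P 0%N) exp_logK; rewrite /qcomp big_ord1 exp0 qmap0n mul1mx.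
Qed.

(** The coefficient of tau^(n+1) in log [t] = ∂[t] log. Here the matrix of tau stands on the right
    and carries the twist, so [L n] enters linearly. *)
Lemma log_rec n : thetadiff n.+1 *: L n.+1 - mxad N (L n.+1) = - (L n *m qmap q n T).
Proof.
have /(congr1 (fun P => P n.+1)) := log_series_comm 'X exp_seriesP.
rewrite qcomp_constl /dpart tcoef_Gsu /qcomp 2!big_ord_recr big1 ?add0r => [|i _]; last first.
  have lt_i := ltn_ord i; rewrite tcoef_Gsu /=.
  case e: (n.+1 - i)%N => [|[|k]]; [lia|lia|].
  by rewrite (qmapE iota) raddf0 mulmx0.
rewrite /= subSn // !subnn !tcoef_Gsu qmap_dpart_Gsu mulmxDr mulmxDl mul_mx_scalar mul_scalar_mx.
move=> eqL; apply: (addIr (L n *m qmap q n T)); rewrite addNr.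
apply: (addrI (th *: L n.+1 + N *m L n.+1)); rewrite addr0 -[RHS]eqL /mxad.
rewrite -[_ * N]/(_ *m N) -[N * _]/(N *m _) opprB scalerBl addrA addrC.
congr (_ + _); first by rewrite add0r.
by rewrite addrACA ![_ + (_ - _)]addrC !subrK.
Qed.

(** * The place at infinity: the entire exponential, and the logarithm near 0 *)

Section LargeTheta.
Context (R : realType) (C : fieldType) (w : absval R C) (j : {rmorphism K -> C}).
Local Notation nrm X := (mxabs w (map_mx j X)).
Local Notation Q := (q%:R : R).
Hypothesis w_complete : vcomplete w.
Hypothesis w_theta : w (j th) = Q.

Let Q_gt1 : 1 < Q. Proof. by rewrite ltr1n q_gt1. Qed.
Let Q_ge0 : 0 <= Q. Proof. by rewrite ler0n. Qed.

Lemma nrm_Gnil (w' : absval R C) : mxabs w' (map_mx j N) <= 1.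
Proof.
apply/mxabs_leP => // a b; rewrite !mxE; case: (_ && _).
  by rewrite rmorph1 abs1.
by rewrite rmorph0 abs0.
Qed.

Lemma abs_thetadiff n : w (j (thetadiff n.+1)) = Q ^+ (q ^ n.+1).
Proof.
rewrite rmorphB rmorphXn absD_dominant absX w_theta // absN w_theta.
by rewrite -[ltLHS]expr1 ltr_eXn2l // -{1}(expn0 q) ltn_exp2l ?q_gt1.
Qed.

Lemma abs_thetadiff_gt1 n : 1 < w (j (thetadiff n.+1)).
Proof. by rewrite abs_thetadiff exprn_egt1 // gtn_eqF ?q_gt0. Qed.

Definition tau_bound : R := Num.max 1 (nrm T).

Lemma tau_bound_ge1 : 1 <= tau_bound. Proof. by rewrite le_max lexx. Qed.
Lemma tau_bound_ge0 : 0 <= tau_bound. Proof. exact: le_trans ler01 tau_bound_ge1. Qed.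

(** The weight n q^n reproduces itself: q (n q^n) + q^(n+1) = (n+1) q^(n+1), the summand q^(n+1)
    coming from |theta^(q^(n+1)) - theta|. The exponent 2 q^n - 1 closes the induction because 1 + q
    (2 q^n - 1) <= 2 q^(n+1) - 1 for q >= 2. *)
Lemma exp_bound n : nrm (E n) * Q ^+ (n * q ^ n) <= tau_bound ^+ (2 * q ^ n).-1.
Proof.
elim: n => [|n IH].
  rewrite mul0n expr0 mulr1 exp0 map_mx1 (le_trans (mxabs1_le _ _)) //.
  exact: exprn_ege1 tau_bound_ge1.
have rec := mxad_bound_large (nrm_Gnil w) (abs_thetadiff_gt1 n) (exp_rec n).
have {rec}rec : Q ^+ (q ^ n.+1) * nrm (E n.+1) <= tau_bound * nrm (E n) ^+ q.
  rewrite -abs_thetadiff (le_trans rec) // map_mxM (le_trans (mxabsM _ _ _)) //.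
  rewrite ler_pM ?mxabs_ge0 // ?le_max ?lexx ?orbT //.
  by rewrite -qmap_map (le_trans (mxabs_qmap _ _ _ _)) // expn1.
rewrite mulSn exprD mulrA [nrm _ * _]mulrC.
apply: (@le_trans _ _ (tau_bound * (nrm (E n) * Q ^+ (n * q ^ n)) ^+ q)).
  rewrite exprMn mulrA -exprM -mulnA -expnSr ler_wpM2r // exprn_ge0 //.
apply: (@le_trans _ _ (tau_bound * (tau_bound ^+ (2 * q ^ n).-1) ^+ q)).
  rewrite ler_wpM2l ?tau_bound_ge0 // lerXn2r ?nnegrE ?mulr_ge0 ?exprn_ge0 ?mxabs_ge0 //.
  exact: tau_bound_ge0.
rewrite -exprM -exprS ler_weXn2l ?tau_bound_ge1 //.
have := q_gt1; have := q_gt0 n; rewrite expnSr; nia.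
Qed.

Lemma exp_bound' n : nrm (E n) * Q ^+ (n * q ^ n) <= (tau_bound ^+ 2) ^+ (q ^ n).
Proof.
by rewrite (le_trans (exp_bound n)) // -exprM ler_weXn2l ?tau_bound_ge1 // leq_pred.
Qed.

Lemma exp_le n : nrm (E n) <= (tau_bound ^+ 2) ^+ (q ^ n).
Proof.
apply: le_trans (exp_bound' n); rewrite ler_peMr ?mxabs_ge0 //.
by rewrite exprn_ege1 // ltW.
Qed.

(** The term is at most (c / Q^i)^(q^i), and the base tends to 0 whatever [M] is: exp is entire. *)
Lemma exp_null M : 0 <= M -> null_seq (fun i => nrm (E i) * M ^+ (q ^ i)).
Proof.
move=> M0; pose c := tau_bound ^+ 2 * M.
have c0 : 0 <= c by rewrite mulr_ge0 ?exprn_ge0 ?tau_bound_ge0.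
have geo : null_seq (fun i => c * Q^-1 ^+ i).
  apply: null_seqZ => //; apply: null_seq_geo.
  by rewrite invr_ge0 Q_ge0 invf_lt1 ?(lt_trans ltr01).
have [I HI] := geo 1 ltr01.
apply: (null_seq_le (N := I)) geo => i /HI lt1.
have x0 : 0 <= c * Q^-1 ^+ i by rewrite mulr_ge0 ?exprn_ge0 ?invr_ge0.
apply: (@le_trans _ _ ((c * Q^-1 ^+ i) ^+ (q ^ i))); last first.
  by rewrite -[leRHS]expr1 ler_wiXn2l ?(ltW lt1) ?q_gt0.
rewrite [(c * _) ^+ _]exprMn [c ^+ _]exprMn -[(Q^-1 ^+ i) ^+ _]exprM exprVn mulrAC.
rewrite ler_wpM2r ?exprn_ge0 //.
by rewrite ler_pdivlMr ?exprn_gt0 ?(lt_trans ltr01) // exp_bound'.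
Qed.

(** The gain from dividing by |theta^(q^n) - theta| is given away; 2 q^n <= q^(n+1) closes the
    induction, and the bound still gives convergence on a small ball. *)
Lemma log_le n : nrm (L n) <= tau_bound ^+ (q ^ n).
Proof.
elim: n => [|n IH].
  by rewrite log0 map_mx1 (le_trans (mxabs1_le _ _)) // exprn_ege1 ?tau_bound_ge1.
have rec := mxad_bound_large (nrm_Gnil w) (abs_thetadiff_gt1 n) (log_rec n).
apply: (@le_trans _ _ (w (j (thetadiff n.+1)) * nrm (L n.+1))).
  by rewrite ler_peMl ?mxabs_ge0 // ltW // abs_thetadiff_gt1.
rewrite (le_trans rec) // map_mxN mxabsN map_mxM (le_trans (mxabsM _ _ _)) //.
apply: (@le_trans _ _ (tau_bound ^+ (q ^ n) * tau_bound ^+ (q ^ n))).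
  rewrite ler_pM ?mxabs_ge0 // -qmap_map (le_trans (mxabs_qmap _ _ _ _)) //.
  by rewrite lerXn2r ?nnegrE ?mxabs_ge0 ?tau_bound_ge0 // le_max lexx orbT.
rewrite -exprD ler_weXn2l ?tau_bound_ge1 // expnS; have := q_gt1; nia.
Qed.

Local Notation expG := (qeval w q j E).
Local Notation logG := (qeval w q j L).

Lemma mxlim_eventually m n (t : nat -> 'M[C]_(m, n)) l k :
  (forall i, (k <= i)%N -> t i = l) -> mxlim w t l.
Proof.
by move=> tl; apply/mxlimP => e e0; exists k => i /tl ->; rewrite subrr mxabs0.
Qed.

Lemma qid_lim z : mxlim w (qsum q j (qid K d) z) z.
Proof.
apply: (@mxlim_eventually _ _ _ _ 1) => -[//|n] _.
rewrite /qsum big_ord_recl qmap0n /= map_mx1 mul1mx big1 ?addr0 // => i _.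
by rewrite map_mx0 mul0mx.
Qed.

Lemma exp_cvg z : qcvg w q j E z.
Proof.
apply: null_qcvg => //; apply: (null_seq_le (N := 0)) (exp_null (mxabs_ge0 w z)) => i _.
by rewrite (le_trans (mxabsM _ _ _)) // ler_wpM2l ?mxabs_ge0 // mxabs_qmap.
Qed.

Lemma null_seq_bounded (a : nat -> R) : null_seq a -> exists2 M, 0 <= M & forall n, a n <= M.
Proof.
move=> /(_ 1 ltr01) [n Hn]; exists (1 + \sum_(i < n) `|a i|).
  by rewrite addr_ge0 // sumr_ge0.
move=> i; have [le_ni|lt_in] := leqP n i.
  by rewrite (le_trans (ltW (Hn i le_ni))) // lerDl sumr_ge0.
rewrite (bigD1 (Ordinal lt_in)) //= addrCA (le_trans (ler_norm _)) // lerDl.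
by rewrite addr_ge0 // sumr_ge0.
Qed.

(** Convergence of log at [z] bounds its terms by some [M], however large; as exp is entire, any [M]
    is admissible in [qcomp_eval]. *)
Lemma exp_log z : qcvg w q j L z -> expG (logG z) = z.
Proof.
move=> cvL; have [M M0 HM] := null_seq_bounded (qcvg_null cvL).
have [l [lim1 lim2]] := qcomp_eval iota w_complete cvL HM (exp_null M0).
by move: lim2; rewrite exp_logK (qeval_lim lim1) => lim2; apply: mxlim_unique lim2 (qid_lim z).
Qed.

(** Both sides of exp ∂[a] = [a] exp are evaluated as composites of series, with [a] a finite
    one. *)
Lemma exp_dpart a z : tapp j (G a) (expG z) = expG (map_mx j (dpart (G a)) *m z).
Proof.
have [n [Gn Gsum]] := tapp_qsum j (G a).
have [M M0 HM] := null_seq_bounded (qcvg_null (exp_cvg z)).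
have [|l [lim1 lim2]] := qcomp_eval (P := tcoef (G a)) iota w_complete (exp_cvg z) HM.
  by move=> e e0; exists n => i /Gn ->; rewrite map_mx0 mxabs0 mul0r.
have limG : mxlim w (qsum q j (tcoef (G a)) (expG z)) (tapp j (G a) (expG z)).
  by apply: (@mxlim_eventually _ _ _ _ n) => i /(Gsum _).
rewrite (mxlim_unique limG lim1).
have lim_c : mxlim w (qsum q j (qconst (dpart (G a))) z) (map_mx j (dpart (G a)) *m z).
  apply: (@mxlim_eventually _ _ _ _ 1) => -[//|i] _.
  rewrite /qsum big_ord_recl qmap0n /= big1 ?addr0 // => k _.
  by rewrite map_mx0 mul0mx.
have cv_c : qcvg w q j (qconst (dpart (G a))) z by exists (map_mx j (dpart (G a)) *m z).
have [M' M'0 HM'] := null_seq_bounded (qcvg_null cv_c).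
have [l' [lim1' lim2']] := qcomp_eval iota w_complete cv_c HM' (exp_null M'0).
move: lim1' lim2'; rewrite (qeval_lim lim_c) => /qeval_lim ->.
by rewrite (proj2 exp_seriesP a); apply: mxlim_unique.
Qed.

(** Two of the three factors come from |E_n| <= (tau_bound^2)^(q^n), which bounds the terms of exp z
    by [M]; the third comes from |L_n| <= tau_bound^(q^n). *)
Lemma log_exp z : tau_bound ^+ 3 * mxabs w z < 1 ->
  qcvg w q j L (expG z) /\ logG (expG z) = z.
Proof.
move=> zsmall; have g1 := tau_bound_ge1; have g0 := tau_bound_ge0.
pose M := tau_bound ^+ 2 * mxabs w z.
have M0 : 0 <= M by rewrite mulr_ge0 ?exprn_ge0 ?mxabs_ge0.
have gM1 : tau_bound * M < 1 by rewrite /M mulrA -exprS.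
have M1 : M <= 1 by rewrite (le_trans _ (ltW gM1)) // ler_peMl.
have HM n : mxabs w (map_mx j (E n) *m qmap q n z) <= M.
  rewrite (le_trans (mxabsM _ _ _)) //.
  apply: (@le_trans _ _ (M ^+ (q ^ n))); last first.
    by rewrite -[leRHS]expr1 ler_wiXn2l ?q_gt0.
  by rewrite exprMn ler_pM ?mxabs_ge0 ?exp_le ?mxabs_qmap.
have Lnull : null_seq (fun i => nrm (L i) * M ^+ (q ^ i)).
  have geo : null_seq (fun i => (tau_bound * M) ^+ i).
    by apply: null_seq_geo; rewrite mulr_ge0.
  apply: (null_seq_le (N := 0)) geo => i _.
  apply: (@le_trans _ _ ((tau_bound * M) ^+ (q ^ i))).
    by rewrite [leRHS]exprMn ler_wpM2r ?exprn_ge0 ?log_le.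
  apply: ler_wiXn2l; [exact: mulr_ge0 | exact: ltW | exact/ltnW/ltn_expl/q_gt1].
have [l [lim1 lim2]] := qcomp_eval iota w_complete (exp_cvg z) HM Lnull.
split; first by exists l.
by move: lim2; rewrite log_expK (qeval_lim lim1) => lim2; apply: mxlim_unique lim2 (qid_lim z).
Qed.

End LargeTheta.

(** * The place [v]: the logarithm on the open unit ball *)

Section SmallTheta.
Context (R : realType) (C : fieldType) (w : absval R C) (j : {rmorphism K -> C}).
Local Notation nrm X := (mxabs w (map_mx j X)).
Hypothesis w_complete : vcomplete w.
Hypothesis T_le1 : nrm T <= 1.
Context (c : R).
Hypothesis c_bounds : 0 < c <= 1.
Hypothesis c_le : forall n, c <= w (j (thetadiff n.+1)).

(** [T] is integral and N^(d+1) = 0, so each step of the recurrence loses at most the factor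
    c^(2(d+1)). *)
Lemma log_small_bound : exists2 B, 1 <= B & forall n, nrm (L n) <= B ^+ n.
Proof.
have [c0 c1] := andP c_bounds; pose e := (d.+1 + d.+1)%N.
have ce0 : 0 < c ^+ e by rewrite exprn_gt0.
exists (c ^+ e)^-1; first by rewrite invf_ge1 // exprn_ile1 // ltW.
elim=> [|n IH]; first by rewrite log0 map_mx1 mxabs1_le.
have := mxad_bound_small (nrm_Gnil j w) (Gnil_nilpotent K s) c_bounds (c_le n) (log_rec n).
rewrite -/e exprS mulrC -ler_pdivlMr // [leRHS]mulrC => h; apply: (le_trans h).
rewrite ler_wpM2l ?invr_ge0 ?(ltW ce0) // map_mxN mxabsN map_mxM.
rewrite (le_trans (mxabsM _ _ _)) // (le_trans _ IH) // ler_piMr ?mxabs_ge0 //.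
by rewrite -qmap_map (le_trans (mxabs_qmap _ _ _ _)) // exprn_ile1 ?mxabs_ge0.
Qed.

Lemma log_cvg_small z : mxabs w z < 1 -> qcvg w q j L z.
Proof.
move=> z1; have [B B1 HB] := log_small_bound; have B0 : 0 <= B := le_trans ler01 B1.
apply: null_qcvg => //; set x := mxabs w z in z1 *.
have x0 : 0 <= x by apply: mxabs_ge0.
(* x^(q^n) decays doubly exponentially: once q^n >= k n, the n-th term is at most (B x^k)^n. *)
have [k Hk] : exists k, B * x ^+ k < 1.
  have geo : null_seq (fun k => B * x ^+ k).
    by apply: null_seqZ => //; apply: null_seq_geo; rewrite x0.
  by have [k Hk] := geo 1 ltr01; exists k; apply: Hk.
have geo : null_seq (fun n => (B * x ^+ k) ^+ n).
  by apply: null_seq_geo; rewrite mulr_ge0 ?exprn_ge0.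
(* For n >= 4k and m = n./2: k n <= (m + 1)^2 <= 4^m <= 2^n. *)
apply: (null_seq_le (N := (4 * k)%N)) geo => n le_kn.
rewrite (le_trans (mxabsM _ _ _)) // exprMn ler_pM ?mxabs_ge0 ?HB //.
rewrite (le_trans (mxabs_qmap _ _ _ _)) // -/x -exprM ler_wiXn2l ?(ltW z1) //.
have le_q : (2 ^ n <= q ^ n)%N by case: (n) => // n'; rewrite leq_exp2r ?q_gt1.
apply: leq_trans le_q; have lt_m := @ltn_expl 2 n./2 isT.
have le_m : (2 ^ (n./2).*2 <= 2 ^ n)%N by rewrite leq_exp2l // -{2}(odd_double_half n) leq_addl.
apply: leq_trans le_m; rewrite -addnn expnD; nia.
Qed.

End SmallTheta.

End GsuSeries.

(** * Orbits under [t] and algebraicity *)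

Section BlockCoordinates.
Context (r : nat) (s : 'I_r -> nat) (L : fieldType).
Local Notation d := (Gdim s).
Implicit Types (z : 'cV[L]_d) (p : 'I_d) (m : 'I_r).

(** A sum with at most one term, so that [m] and [i] need no dependent type and an index beyond the
    block gives 0. *)
Definition crd z m (i : nat) : L :=
  \sum_(p < d | (tagnat.sig1 p == m) && (tagnat.sig2 p == i :> nat)) z p 0.

Lemma sig_eq (p p' : 'I_d) : (p == p')
  = (tagnat.sig1 p == tagnat.sig1 p') && (tagnat.sig2 p == tagnat.sig2 p' :> nat).
Proof. by rewrite -val_eqE -tagnat.eq_Rank !tagnat.sig2K. Qed.

Lemma crd_sig z p : crd z (tagnat.sig1 p) (tagnat.sig2 p) = z p 0.
Proof. by rewrite /crd (big_pred1 p) // => p'; rewrite /= sig_eq. Qed.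

Lemma crd_ex m i : (i < dsz s m)%N ->
  exists p : 'I_d, tagnat.sig1 p = m /\ (tagnat.sig2 p = i :> nat).
Proof.
move=> lt_i; exists (@tagnat.Rank _ (dsz s) m (Ordinal lt_i)); split.
  exact: tagnat.Rank1K.
by rewrite tagnat.Rank2K.
Qed.

Lemma crd_default z m i : (dsz s m <= i)%N -> crd z m i = 0.
Proof.
move=> le_i; rewrite /crd big_pred0 // => p; apply/negP => /andP[/eqP pm /eqP pi].
by have := ltn_ord (tagnat.sig2 p); rewrite pi pm ltnNge le_i.
Qed.

Lemma dsz_gt0 m : (forall i, (0 < s i)%N) -> (0 < dsz s m)%N.
Proof. by move=> s_gt0; rewrite /dsz (bigD1 m) //= addn_gt0 s_gt0. Qed.

End BlockCoordinates.

Section Orbit.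
Context (F : finFieldType) (K : fieldType) (iota : {rmorphism {fraction {poly F}} -> K}).
Context (r : nat) (s : 'I_r -> nat) (u : 'I_r -> K).
Context (L : fieldType) (j : {rmorphism K -> L}).
Hypothesis s_gt0 : forall i, (0 < s i)%N.
Local Notation q := #|F|.
Local Notation G := (Gsu iota s u).
Local Notation d := (Gdim s).
Local Notation jth := (j (theta iota)).
Local Notation jF := (j \o kconst iota).
Implicit Types (z : 'cV[L]_d).

Definition taucoef (m m' : 'I_r) : K :=
  if (m <= m')%N then (-1) ^+ (m' - m) * \prod_(k < r | (m <= k < m')%N) u k else 0.

Lemma taucoef_diag m : taucoef m m = 1.
Proof.
rewrite /taucoef leqnn subnn mul1r big_pred0 // => k.
by rewrite ltnNge andbN.
Qed.

Lemma tapp_GX z : tapp j (G 'X) z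
  = map_mx j ((theta iota)%:M + Gnil K s) *m z + map_mx j (Gtau s u) *m qmap q 1 z.
Proof.
have [n [_ HN]] := tapp_qsum j (G 'X); rewrite -(HN z n.+2) ?leqW ?leqnSn //.
rewrite /qsum 2!big_ord_recl big1 ?addr0 => [|i _].
  by rewrite !tcoef_Gsu /= qmap0n.
by rewrite tcoef_Gsu /= map_mx0 mul0mx.
Qed.

Lemma crd_GX z (m : 'I_r) (i : nat) : (i < dsz s m)%N ->
  crd (tapp j (G 'X) z) m i = jth * crd z m i + crd z m i.+1
    + (if i.+1 == dsz s m then
         \sum_(m' < r | (m <= m')%N) j (taucoef m m') * crd z m' 0 ^+ q else 0).
Proof.
move=> /crd_ex[p [<- <-]]; rewrite !crd_sig tapp_GX map_mxD mulmxDl map_scalar_mx.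
have boolE (b : bool) (y : L) : j b%:R * y = if b then y else 0.
  by case: b; rewrite /= ?rmorph1 ?mul1r ?rmorph0 ?mul0r.
rewrite mul_scalar_mx mxE [X in X + _]mxE [(_ *: z) p 0]mxE; congr (_ + _ + _).
  rewrite mxE /crd [RHS]big_mkcond; apply: eq_bigr => p' _; rewrite !mxE [tagnat.sig1 p' == _]eq_sym.
  exact: boolE.
have crdq m' : crd z m' 0 ^+ q
    = \sum_(p' < d | (tagnat.sig1 p' == m') && (tagnat.sig2 p' == 0 :> nat)) z p' 0 ^+ q.
  rewrite /crd -[q]expn1 -[LHS]/(frobn (j \o iota) 1 _) rmorph_sum.
  by apply: eq_bigr => p' _; rewrite /= /frobn expn1.
rewrite mxE; case: eqP => [e|ne]; last first.
  apply: big1 => p' _; rewrite !mxE; case: ifP => [/and3P[_ /eqP/ne]//|_].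
  by rewrite rmorph0 mul0r.
transitivity (\sum_(p' < d | tagnat.sig2 p' == 0 :> nat)
    j (taucoef (tagnat.sig1 p) (tagnat.sig1 p')) * z p' 0 ^+ q).
  rewrite [RHS]big_mkcond /=; apply: eq_bigr => p' _; rewrite !mxE e eqxx /= expn1 /taucoef.
  by case: (_ == 0%N); case: leqP => //=; rewrite ?rmorph0 ?mul0r.
rewrite (partition_big (fun p' : 'I_d => tagnat.sig1 p' : 'I_r) predT) //= [RHS]big_mkcond.
apply: eq_bigr => m' _; case: leqP => [le_m|lt_m].
  rewrite crdq big_distrr /=; apply: eq_big => [p'|p' /andP[_ /eqP <-] //].
  exact: andbC.
apply: big1 => p' /andP[_ /eqP ->]; by rewrite /taucoef leqNgt lt_m rmorph0 mul0r.
Qed.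

Definition orbit_seq z (m : 'I_r) : nat -> L := fun k => crd (tapp j (G ('X ^+ k)) z) m 0.

Lemma tapp_XS z k : tapp j (G ('X ^+ k.+1)) z = tapp j (G 'X) (tapp j (G ('X ^+ k)) z).
Proof. by rewrite exprS rmorphM tappM. Qed.

(** Before the last row of a block, [t] is theta plus the next coordinate, so each factor S - theta
    moves one coordinate down the block. *)
Lemma act_orbit z m i k : (i < dsz s m)%N ->
  act (('X - jth%:P) ^+ i) (orbit_seq z m) k = crd (tapp j (G ('X ^+ k)) z) m i.
Proof.
have aux (a b : L) : a + b + 0 - a = b by rewrite addr0 addrAC subrr add0r.
elim: i k => [|i IH] k lt_i; first by rewrite expr0 act1.
rewrite exprS act_mul actB actX actC !IH ?(ltnW lt_i) // tapp_XS crd_GX ?(ltnW lt_i) //.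
by rewrite ltn_eqF // aux.
Qed.

Lemma orbit_coord z (p : 'I_d) k : tapp j (G ('X ^+ k)) z p 0
  = act (('X - jth%:P) ^+ (tagnat.sig2 p)) (orbit_seq z (tagnat.sig1 p)) k.
Proof. by rewrite act_orbit // crd_sig. Qed.

(** One more factor S - theta, applied at the last coordinate of the block, leaves only the row of
    tau. *)
Lemma orbit_trisol z m k : act (('X - jth%:P) ^+ dsz s m) (orbit_seq z m) k
  = \sum_(m' < r | (m <= m')%N) j (taucoef m m') * orbit_seq z m' k ^+ q.
Proof.
have aux (a b : L) : a + 0 + b - a = b by rewrite addr0 addrAC subrr add0r.
have d_gt0 := dsz_gt0 m s_gt0; rewrite -{1}(prednK d_gt0) exprS act_mul actB actX actC.
rewrite !act_orbit ?ltn_predL // tapp_XS crd_GX ?ltn_predL // prednK // eqxx.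
by rewrite (crd_default _ (leqnn _)) aux.
Qed.

Lemma act_tapp b z p k :
  act (map_poly jF b) (fun k => tapp j (G ('X ^+ k)) z p 0) k
    = tapp j (G b) (tapp j (G ('X ^+ k)) z) p 0.
Proof.
have tC c z' : tapp j (G c%:P) z' = jF c *: z'.
  by rewrite -[c%:P]mulr1 mul_polyC tact_linear rmorph1 mulr1 tapp_Fscal.
elim/poly_ind: b k => [|b c IH] k.
  by rewrite -polyC0 tC map_polyC actC [RHS]mxE.
rewrite rmorphD rmorphM /= map_polyX map_polyC /= actD actMX IH actC.
by rewrite tapp_XS rmorphD rmorphM tappD tappM tC [RHS]mxE [X in _ = _ + X]mxE.
Qed.

(** [b] commutes with [t^k], so a polynomial in the shift with coefficients in F_q amounts to a
    change of the starting point. *)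
Lemma orbit_act b z m k : act (map_poly jF b) (orbit_seq z m) k = orbit_seq (tapp j (G b) z) m k.
Proof.
have [p [pm p0]] := crd_ex (dsz_gt0 m s_gt0).
have crdE z' : crd z' m 0 = z' p 0 by have := crd_sig z' p; rewrite p0 pm.
rewrite /orbit_seq crdE (eq_act _ (fun k => crdE _)) act_tapp.
by rewrite -!tappM -!rmorphM mulrC.
Qed.

End Orbit.

Lemma orbit_seq_map (F : finFieldType) (K L : fieldType)
    (iota : {rmorphism {fraction {poly F}} -> K}) (j : {rmorphism K -> L})
    (r : nat) (s : 'I_r -> nat) (u : 'I_r -> K) (x : 'cV[K]_(Gdim s)) m k :
  orbit_seq iota u j (map_mx j x) m k = j (orbit_seq iota u idfun x m k).
Proof.
rewrite /orbit_seq /crd rmorph_sum; apply: eq_bigr => p _.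
have := congr1 (fun y : 'cV[L]_(Gdim s) => y p 0) (map_tapp idfun j (Gsu iota s u ('X ^+ k)) x).
by rewrite mxE => ->.
Qed.

(** All powers g_i^(q^k) lie in a K-span of n elements, so n + 1 of them are dependent. The
    exponents being distinct, this is a nonzero polynomial over the algebraically closed [K] with
    root g_i. *)
Lemma frobenius_span_algebraic (F : finFieldType) (K : closedFieldType)
    (iota : {rmorphism {fraction {poly F}} -> K}) (L : fieldType) (j : {rmorphism K -> L})
    (I : finType) (g : I -> L) (B : I -> I -> K) :
    (forall i, g i ^+ #|F| = \sum_k j (B i k) * g k) ->
  forall i, exists a, j a = g i.
Proof.
move=> gB i; pose n := #|I|; pose q := #|F|.
pose gc : 'cV[L]_n := \col_k g (enum_val k).
pose Bm : 'M[K]_n := \matrix_(a, b) B (enum_val a) (enum_val b).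
have gcB : qmap q 1 gc = map_mx j Bm *m gc.
  apply/matrixP => a c; rewrite !mxE expn1 gB.
  rewrite (reindex (@enum_val _ I)) /=; last exact: onW_bij (enum_val_bij I).
  by apply: eq_bigr => b _; rewrite !mxE.
(* [rho k] is a row of coefficients expressing g_i^(q^k) in the family [g]. *)
pose rho := fix rho k : 'rV[K]_n :=
  if k is k'.+1 then qmap q 1 (rho k') *m Bm else delta_mx 0 (enum_rank i).
have rhoE k : (map_mx j (rho k) *m gc) 0 0 = g i ^+ (q ^ k).
  elim: k => [|k IH].
    by rewrite map_delta_mx -rowE !mxE enum_rankK expr1.
  rewrite /= map_mxM -mulmxA -gcB -qmap_map !(qmapE (j \o iota)) -map_mxM mxE IH.
  by rewrite /= /frobn -exprM -expnD addn1.
pose A : 'M[K]_(n.+1, n) := \matrix_k rho k.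
have : kermx A != 0.
  by rewrite kermx_eq0 /row_free neq_ltn ltnS rank_leq_col.
move=> /rowV0Pn[v /sub_kermxP vA v0].
pose P : {poly K} := \sum_(k < n.+1) v 0 k *: 'X^(q ^ k).
have q1 : (1 < q)%N by apply: finNzRing_gt1.
have P0 : P != 0.
  apply: contraNneq v0 => P0; apply/eqP/rowP => k; rewrite mxE.
  have := congr1 (fun p : {poly K} => p`_(q ^ k)) P0; rewrite coef0 coef_sum (bigD1 k) //=.
  rewrite big1 => [|k' ne]; first by rewrite addr0 coefZ coefXn eqxx mulr1.
  by rewrite coefZ coefXn eqn_exp2l // eq_sym (negPf ne : (k' == k :> nat) = false) mulr0.
have Pg : root (map_poly j P) (g i).
  rewrite rootE rmorph_sum horner_sum; apply/eqP.
  transitivity ((map_mx j (v *m A) *m gc) 0 0); last by rewrite vA map_mx0 mul0mx mxE.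
  rewrite map_mxM -mulmxA mxE; apply: eq_bigr => k _.
  have -> : (map_mx j A *m gc) k 0 = (map_mx j (rho k) *m gc) 0 0.
    by rewrite mxE [RHS]mxE; apply: eq_bigr => b _; rewrite !mxE.
  by rewrite rhoE mxE /= map_polyZ map_polyXn hornerZ hornerXn.
have [rs Prs] := closed_field_poly_normal P.
move: Pg; rewrite Prs map_polyZ rootZ ?fmorph_eq0 ?lead_coef_eq0 //.
rewrite rmorph_prod (eq_bigr (fun a => 'X - (j a)%:P)) => [|a _]; last first.
  by rewrite rmorphB /= map_polyX map_polyC.
rewrite -(big_map j predT (fun b => 'X - b%:P)) root_prod_XsubC => /mapP[a _ ->].
by exists a.
Qed.

Section OrbitAlgebraic.
Context (F : finFieldType) (K : closedFieldType) (iota : {rmorphism {fraction {poly F}} -> K}).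
Context (r : nat) (s : 'I_r -> nat) (u : 'I_r -> K).
Context (L : fieldType) (j : {rmorphism K -> L}).
Hypothesis s_gt0 : forall i, (0 < s i)%N.
Local Notation q := #|F|.
Local Notation G := (Gsu iota s u).
Local Notation d := (Gdim s).

(* The K-span of 1 and the first coordinates of the blocks of [t^k]z is finite dimensional, and
   the structure equations make it stable under the q-power map. *)
Lemma tapp_algebraic (a : {poly F}) (x : 'cV[K]_d) (z : 'cV[L]_d) :
  a \is monic -> tapp j (G a) z = map_mx j x -> exists y : 'cV[K]_d, map_mx j y = z.
Proof.
move=> a_monic az; pose D := (size a).-1.
have size_a : size a = D.+1 by rewrite prednK // size_poly_gt0 monic_neq0.
pose f := orbit_seq iota u j z.
pose g (i : option ('I_r * 'I_D)) : L := if i is Some mk then f mk.1 mk.2 else 1.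
pose V y := exists c : option ('I_r * 'I_D) -> K, y = \sum_i j (c i) * g i.
have VD y y' : V y -> V y' -> V (y + y').
  move=> [c ->] [c' ->]; exists (fun i => c i + c' i); rewrite -big_split.
  by apply: eq_bigr => i _; rewrite rmorphD mulrDl.
have VZ b y : V y -> V (j b * y).
  move=> [c ->]; exists (fun i => b * c i); rewrite big_distrr /=.
  by apply: eq_bigr => i _; rewrite rmorphM mulrA.
have V0 : V 0 by exists (fun=> 0); rewrite big1 // => i _; rewrite rmorph0 mul0r.
have Vsum (I : Type) (l : seq I) (P : pred I) (h : I -> L) :
    (forall i, P i -> V (h i)) -> V (\sum_(i <- l | P i) h i).
  by move=> Vh; elim/big_ind: _.
have VB y y' : V y -> V y' -> V (y - y').
  by move=> Vy Vy'; rewrite -[y']mul1r -mulNr -[-1]/(- 1 : L) -(rmorph1 j) -rmorphN; apply/VD/VZ.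
have Vg i : V (g i).
  exists (fun i' => (i' == i)%:R).
  rewrite (bigD1 i) //= eqxx rmorph1 mul1r big1 ?addr0 // => i' /negPf->.
  by rewrite rmorph0 mul0r.
have Vact (p : {poly K}) (h : nat -> L) k : (forall k, V (h k)) -> V (act (map_poly j p) h k).
  by move=> Vh; apply: Vsum => i _; rewrite coef_map; apply/VZ/Vh.
have Vf m k : V (f m k).
  have [e] := ubnP k; elim: e k => // e IH k lt_k.
  have [lt_D|le_D] := ltnP k D; first exact: (Vg (Some (m, Ordinal lt_D))).
  (* As [a] is monic of degree [D], its action gives a recurrence of order [D] whose inhomogeneous
     term comes from the orbit of [x], hence from [K]. *)
  have -> : f m k = j (orbit_seq iota u idfun x m (k - D)) * g None
      - \sum_(i < D) (map_poly (j \o kconst iota) a)`_i * f m (k - D + i)%N.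
    rewrite mulr1 -orbit_seq_map -az -orbit_act //.
    rewrite (act_widen (n := D.+1)) ?size_map_poly ?size_a // big_ord_recr /=.
    have -> : (map_poly (j \o kconst iota) a)`_D = 1.
      by rewrite coef_map /= (monicP a_monic : a`_D = 1) !rmorph1.
    by rewrite mul1r subnK // addrAC subrr add0r.
  apply: VB; first exact/VZ/Vg.
  by apply: Vsum => i _; rewrite coef_map; apply/VZ/IH; have := ltn_ord i; lia.
have jX : 'X - (j (theta iota))%:P = map_poly j ('X - (theta iota)%:P).
  by rewrite rmorphB /= map_polyX map_polyC.
(* The diagonal coefficient is 1, so the structure equation isolates the q-th power in block [m]
   once those of the higher blocks are known. *)
have Vfq m : forall k, V (f m k ^+ q).
  move: m; apply: descending_ind => m IH k.
  have -> : f m k ^+ q = act (('X - (j (theta iota))%:P) ^+ dsz s m) (f m) k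
      - \sum_(m' < r | (m <= m')%N && (m' != m)) j (taucoef u m m') * f m' k ^+ q.
    by rewrite orbit_trisol // (bigD1 m) //= taucoef_diag rmorph1 mul1r addrK.
  apply: VB; first by rewrite jX -rmorphXn; apply/Vact/Vf.
  apply: Vsum => m' /andP[le_m ne_m]; apply/VZ/IH.
  by rewrite ltn_neqAle le_m andbT eq_sym.
have Vgq i : exists c : option ('I_r * 'I_D) -> K, g i ^+ q = \sum_k j (c k) * g k.
  by case: i => [[m k]|]; [apply: Vfq | have := Vg None; rewrite /= expr1n].
have [B HB] := choice Vgq.
have gK := frobenius_span_algebraic iota HB.
have VK y : V y -> exists b, j b = y.
  move=> [c ->]; have [h Hh] := choice gK; exists (\sum_i c i * h i).
  by rewrite rmorph_sum; apply: eq_bigr => i _; rewrite rmorphM Hh.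
have zK p : exists b, j b = z p 0.
  apply: VK; have := orbit_coord iota u j z p 0%N; rewrite expr0 rmorph1 tapp1 => ->.
  by rewrite jX -rmorphXn; apply: Vact; apply: Vf.
have [y Hy] := choice zK; exists (\col_p y p).
by apply/matrixP => p c; rewrite !mxE Hy [c]ord1.
Qed.

End OrbitAlgebraic.

(** * The place [v] *)

Section IrreduciblePolynomial.
Context (F : finFieldType) (K : fieldType) (iota : {rmorphism {fraction {poly F}} -> K}).
Context (v : {poly F}) (v_monic : v \is monic) (v_irr : irreducible_poly v).
Local Notation q := #|F|.
Local Notation D := (size v).-1.
Local Notation kv := (map_poly (kconst iota)).

Lemma irreducible_coprime g : ~~ (v %| g) -> coprimep v g.
Proof.
have [_ irr] := v_irr; apply: contraNT => gcd_ne1.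
have /andP[_ v_gcd] : gcdp v g %= v by apply: irr; rewrite ?dvdp_gcdl.
exact: dvdp_trans v_gcd (dvdp_gcdr _ _).
Qed.

Lemma size_irr : size v = D.+1.
Proof. by rewrite prednK // size_poly_gt0 monic_neq0. Qed.

Lemma frob_root_kv (g : {poly F}) n a : (kv g).[a] ^+ (q ^ n) = (kv g).[a ^+ (q ^ n)].
Proof.
have fixed : map_poly (frobn iota n) (kv g) = kv g.
  apply/polyP => i; rewrite !coef_map /= /frobn -(iter_frob iota).
  by elim: n => //= n ->; rewrite frob_kconst.
rewrite -[in RHS]fixed; exact/esym/(horner_map (frobn iota n)).
Qed.

Context (al : K).
Hypothesis al_root : root (kv v) al.

Lemma root_kv_neq0 (g : {poly F}) : ~~ (v %| g) -> (kv g).[al] != 0.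
Proof.
move=> /irreducible_coprime/Bezout_eq1_coprimepP[[a b] /= eq1].
have := congr1 (fun p => (kv p).[al]) eq1; rewrite rmorphD !rmorphM rmorph1 /= !hornerE.
rewrite (rootP al_root) mulr0 add0r => eq1'; apply/eqP => g0.
by move/eqP: eq1'; rewrite g0 mulr0 eq_sym oner_eq0.
Qed.

(** The q^D polynomials of degree below [D] take distinct values at [al], and all these values are
    roots of X^(q^e) - X. *)
Lemma frob_period_ge e : (0 < e)%N -> al ^+ (q ^ e) = al -> (D <= e)%N.
Proof.
move=> e_gt0 al_e; have q1 : (1 < q)%N := finNzRing_gt1 F.
pose rs := [seq (kv (rVpoly x)).[al] | x : 'rV[F]_D].
pose p : {poly K} := 'X ^+ (q ^ e) - 'X.
have qe1 : (1 < q ^ e)%N by rewrite -{1}(expn0 q) ltn_exp2l.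
have size_p : size p = (q ^ e).+1.
  by rewrite size_polyDl ?size_polyXn // size_polyN size_polyX.
have p0 : p != 0 by rewrite -size_poly_gt0 size_p.
have rs_uniq : uniq rs.
  rewrite map_inj_uniq ?enum_uniq // => x y /eqP.
  rewrite -subr_eq0 -hornerN -hornerD -rmorphB -linearB /= => xy0.
  apply/eqP; rewrite -subr_eq0 -[x - y]rVpolyK; apply: contraTT xy0 => xy_ne0.
  apply: root_kv_neq0; apply: contra xy_ne0 => v_dvd.
  suff -> : rVpoly (x - y) = 0 by rewrite linear0.
  apply/eqP; apply: contraTT v_dvd => nz; rewrite gtNdvdp //.
  by apply: leq_ltn_trans (size_poly _ _) _; rewrite prednK // size_poly_gt0 monic_neq0.
have rs_root : all (root p) rs.
  apply/allP => _ /mapP[x _ ->]; rewrite rootE !hornerE frob_root_kv al_e.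
  by rewrite subrr.
have := max_poly_roots p0 rs_root rs_uniq.
by rewrite size_p size_map -cardE card_mx mul1n ltnS leq_exp2l.
Qed.

Lemma frob_pow_inj n a b : a ^+ (q ^ n) = b ^+ (q ^ n) -> a = b :> K.
Proof. exact: (fmorph_inj (frobn iota n)). Qed.

Lemma frob_orbit_uniq : uniq [seq al ^+ (q ^ i) | i <- seq.iota 0 D].
Proof.
rewrite map_inj_in_uniq ?iota_uniq // => i k; rewrite !mem_iota /= !add0n => lt_i lt_k.
wlog le_ik : i k lt_i lt_k / (i <= k)%N.
  by move=> H; case: (leqP i k) => [|/ltnW] le e; [apply: H | apply/esym/H].
rewrite -(subnK le_ik) expnD exprM => /frob_pow_inj/esym al_e.
have [e0|e_gt0] := posnP (k - i)%N; first by lia.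
by have := frob_period_ge e_gt0 al_e; rewrite leqNgt (leq_ltn_trans (leq_subr _ _) lt_k).
Qed.

Lemma kv_prod : kv v = \prod_(i < D) ('X - (al ^+ (q ^ i))%:P).
Proof.
have -> : kv v = lead_coef (kv v) *: \prod_(z <- [seq al ^+ (q ^ i) | i <- seq.iota 0 D]) ('X - z%:P).
  apply: all_roots_prod_XsubC; rewrite ?uniq_rootsE ?frob_orbit_uniq //.
    by rewrite size_map_poly size_map size_iota size_irr.
  apply/allP => _ /mapP[i _ ->]; rewrite rootE -frob_root_kv (rootP al_root).
  by rewrite expr0n expn_eq0 -leqn0 leqNgt (ltnW (finNzRing_gt1 F)).
rewrite lead_coef_map (monicP v_monic) rmorph1 scale1r big_map.
have -> : seq.iota 0 D = index_iota 0 D by rewrite /index_iota subn0.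
by rewrite big_mkord.
Qed.

(** al^(q^D) is again a root of [v], hence equals al^(q^i) for some i < D; cancelling q^i gives the
    period D - i, which is at least D, so i = 0. *)
Lemma frob_period : al ^+ (q ^ D) = al.
Proof.
have : root (kv v) (al ^+ (q ^ D)).
  rewrite rootE -frob_root_kv (rootP al_root).
  by rewrite expr0n expn_eq0 -leqn0 leqNgt (ltnW (finNzRing_gt1 F)).
rewrite kv_prod rootE horner_prod prodf_seq_eq0 => /hasP[i _].
rewrite hornerXsubC subr_eq0 => /= /eqP.
have lt_iD := ltn_ord i; rewrite -{1}(subnK (ltnW lt_iD)) expnD exprM => /frob_pow_inj al_e.
have := frob_period_ge _ al_e; rewrite subn_gt0 lt_iD => /(_ isT).
case: (nat_of_ord i) lt_iD al_e => [|i'] lt_iD al_e; last by lia.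
by rewrite subn0 in al_e.
Qed.

End IrreduciblePolynomial.

Section IntegralTheta.
Context (F : finFieldType) (K : closedFieldType) (iota : {rmorphism {fraction {poly F}} -> K}).
Context (v : {poly F}) (v_monic : v \is monic) (v_irr : irreducible_poly v).
Context (R : realType) (C : fieldType) (w : absval R C) (j : {rmorphism K -> C}).
Local Notation q := #|F|.
Hypothesis w_v : w (j (thetaev iota v)) < 1.
Local Notation kv := (map_poly (kconst iota)).

(** c^q = c forces |c|^q = |c|, which excludes |c| > 1. *)
Lemma abs_kconst_le1 (C' : fieldType) (w' : absval R C') (j' : {rmorphism K -> C'}) c :
  w' (j' (kconst iota c)) <= 1.
Proof.
have q1 : (1 < q)%N := finNzRing_gt1 F.
have := congr1 (fun y => w' (j' y)) (frob_kconst iota c).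
rewrite /= /frob rmorphXn absX => e; rewrite leNgt; apply/negP => gt1.
by have := ltr_eXn2l gt1 1 q; rewrite expr1 e ltxx q1.
Qed.

Lemma integral_root (p : {poly K}) a : p \is monic -> (forall i, w (j p`_i) <= 1) ->
  root p a -> w (j a) <= 1.
Proof.
move=> p_monic p_int pa; rewrite leNgt; apply/negP => gt1.
have a0 : 0 <= w (j a) by apply: abs_ge0.
have size_p : size p = (size p).-1.+1 by rewrite prednK // size_poly_gt0 monic_neq0.
have := rootP pa; rewrite horner_coef size_p big_ord_recr /=.
have -> : p`_(size p).-1 = 1 := monicP p_monic.
case: (size p).-1 => [|n].
  by rewrite big_ord0 add0r mulr1 => /eqP; rewrite oner_eq0.
rewrite mul1r addrC => /eqP; rewrite addr_eq0 => /eqP e.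
have : w (j (a ^+ n.+1)) <= w (j a) ^+ n.
  rewrite e rmorphN absN rmorph_sum; apply: abs_sum_le => [|i _]; first exact: exprn_ge0.
  rewrite rmorphM absM rmorphXn absX (le_trans (ler_wpM2r (exprn_ge0 _ a0) (p_int i))) //.
  by rewrite mul1r ler_weXn2l ?(ltW gt1) // -ltnS.
by rewrite rmorphXn absX leNgt ltr_eXn2l ?ltnS ?leqnn.
Qed.

(** v(theta) is the product of theta - a over the roots a of [v], so some factor is small. Modulo
    the maximal ideal, theta is thus replaced by an element with a known Frobenius orbit. *)
Lemma near_root : exists al, [/\ root (kv v) al, w (j al) <= 1 & w (j (theta iota - al)) < 1].
Proof.
have kv_monic : kv v \is monic by rewrite map_monic.
have kv_int i : w (j (kv v)`_i) <= 1 by rewrite coef_map; apply: abs_kconst_le1.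
have [rs Hrs] := closed_field_poly_normal (kv v).
rewrite (monicP kv_monic) scale1r in Hrs.
have [/hasP[al al_rs small]|/hasPn large] := boolP (has (fun a => w (j (theta iota - a)) < 1) rs).
  exists al; have al_root : root (kv v) al by rewrite Hrs root_prod_XsubC.
  by split=> //; apply: integral_root al_root.
suff : 1 <= w (j (thetaev iota v)) by rewrite leNgt w_v.
rewrite thetaevE Hrs horner_prod rmorph_prod abs_prod big_seq.
elim/big_ind: _ => // [x y x1 y1|a ars]; first by rewrite -[1]mulr1 ler_pM.
by rewrite hornerXsubC leNgt large.
Qed.

Lemma abs_theta_le1 : w (j (theta iota)) <= 1.
Proof.
have [al [_ al1 th_al]] := near_root.
by rewrite -(subrK al (theta iota)) rmorphD absD_le // ltW.
Qed.

Lemma abs_thetaev_le1 a : w (j (thetaev iota a)) <= 1.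
Proof.
elim/poly_ind: a => [|a c IH]; first by rewrite !rmorph0 abs0.
rewrite !(rmorphD, rmorphM) absD_le ?abs_kconst_le1 // absM.
by rewrite mulr_ile1 ?abs_ge0 ?abs_theta_le1.
Qed.

Lemma abs_thetaev_ndvd a : ~~ (v %| a) -> 1 <= w (j (thetaev iota a)).
Proof.
move=> /(irreducible_coprime v_irr)/Bezout_eq1_coprimepP[[b c] /= eq1].
rewrite leNgt; apply/negP => lt1.
have := congr1 (fun p => w (j (thetaev iota p))) eq1.
rewrite !(rmorphD, rmorphM, rmorph1) abs1 => e1.
have small x y : w (j (thetaev iota y)) < 1 -> w (j (thetaev iota x) * j (thetaev iota y)) < 1.
  by move=> y1; rewrite absM (le_lt_trans _ y1) // ler_piMl ?abs_ge0 ?abs_thetaev_le1.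
by have := absD_lt (small b v w_v) (small c a lt1); rewrite e1 ltxx.
Qed.

(* [X^(q^n) - X] is separable, so [v] divides it at most once. *)
Lemma abs_thetadiff_ge n : w (j (thetaev iota v)) <= w (j (thetadiff iota n.+1)).
Proof.
have q0 k : (0 < q ^ k)%N by rewrite expn_gt0 ltnW ?finNzRing_gt1.
pose f : {poly F} := 'X ^+ (q ^ n.+1) - 'X.
have -> : thetadiff iota n.+1 = thetaev iota f by rewrite rmorphB rmorphXn.
have [|/abs_thetaev_ndvd] := boolP (v %| f); last exact: le_trans (ltW w_v).
move=> /dvdpP[g f_gv]; have /abs_thetaev_ndvd g1 : ~~ (v %| g).
  apply/negP => v_g; have : f^`() = -1.
    rewrite derivB derivXn derivX; have -> : 'X ^+ (q ^ n.+1).-1 *+ (q ^ n.+1) = 0 :> {poly F}.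
      rewrite -mulr_natr; suff -> : (q ^ n.+1)%:R = 0 :> {poly F} by rewrite mulr0.
      rewrite natrX; suff -> : q%:R = 0 :> {poly F} by rewrite expr0n.
      rewrite -polyC_natr; suff -> : q%:R = 0 :> F by [].
      apply: (fmorph_inj (kconst iota)); rewrite rmorph_nat rmorph0.
      apply/eqP; rewrite -[_ == 0]negbK natf_neq0_pchar; apply/negP => q'.
      by have := finNzRing_gt1 F; rewrite (pnat_1 (pnat_card_pchar iota) q').
    by rewrite sub0r.
  rewrite f_gv derivM => e.
  have [v1 _] := v_irr; have : v %| (-1 : {poly F}).
    by rewrite -e; apply: dvdp_add; [apply: dvdp_mull | apply: dvdp_mulr].
  rewrite -scaleN1r dvdpZr ?oppr_eq0 ?oner_eq0 // dvdp1 => /eqP sv.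
  by rewrite sv in v1.
by rewrite f_gv rmorphM rmorphM absM ler_peMl ?abs_ge0.
Qed.

End IntegralTheta.

(** * Integrality and reduction modulo [v] *)

(** A maximum other than 1 is attained, which gives an index at which to use the structure
    equation. *)
Lemma prefix_max (R : realDomainType) (h : nat -> R) n :
  exists M, [/\ 1 <= M, forall k, (k < n)%N -> h k <= M & M = 1 \/ exists k, M = h k].
Proof.
elim: n => [|n [M [M1 HM HM']]]; first by exists 1; split=> //; left.
have [le_M|lt_M] := leP (h n) M.
  exists M; split=> // k; rewrite ltnS leq_eqVlt => /orP[/eqP -> //|]; exact: HM.
exists (h n); split=> [|k|]; last by right; exists n.
  exact: le_trans M1 (ltW lt_M).
rewrite ltnS leq_eqVlt => /orP[/eqP -> //|/HM le_h].
exact: le_trans le_h (ltW lt_M).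
Qed.

Section IntegralAction.
Context (R : realType) (C : fieldType) (w : absval R C).
Implicit Types (p : {poly C}) (h : nat -> C).

Definition intpoly p := forall i, w p`_i <= 1.

Lemma intpolyM p p' : intpoly p -> intpoly p' -> intpoly (p * p').
Proof.
move=> pi pi' i; rewrite coefM; apply: abs_sum_le => // k _.
by rewrite absM mulr_ile1 ?abs_ge0.
Qed.

Lemma intpoly_XsubC c n : w c <= 1 -> intpoly (('X - c%:P) ^+ n).
Proof.
move=> c1; elim: n => [|n IH].
  by move=> i; rewrite expr0 coef1; case: eqP; rewrite ?abs1 ?abs0.
rewrite exprS; apply: intpolyM => // i; rewrite coefB coefX coefC absB_le //.
  by case: eqP; rewrite ?abs1 ?abs0.
by case: eqP; rewrite ?abs0.
Qed.

Lemma act_abs_le p h k B : intpoly p -> 0 <= B -> (forall k, w (h k) <= B) ->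
  w (act p h k) <= B.
Proof.
move=> p1 B0 hB; apply: abs_sum_le => // i _.
by rewrite absM (le_trans _ (hB (k + i)%N)) // ler_piMl ?abs_ge0.
Qed.

Lemma act_abs_lt p h k B : intpoly p -> 0 < B -> (forall k, w (h k) < B) ->
  w (act p h k) < B.
Proof.
move=> p1 B0 hB; rewrite /act; elim/big_ind: _ => [|x y|i _]; first by rewrite abs0.
  exact: absD_lt.
by rewrite absM (le_lt_trans _ (hB (k + i)%N)) // ler_piMl ?abs_ge0.
Qed.

End IntegralAction.

Section OrbitIntegral.
Context (F : finFieldType) (K : closedFieldType) (iota : {rmorphism {fraction {poly F}} -> K}).
Context (r : nat) (s : 'I_r -> nat) (u : 'I_r -> K).
Context (R : realType) (C : fieldType) (w : absval R C) (j : {rmorphism K -> C}).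
Hypothesis s_gt0 : forall i, (0 < s i)%N.
Hypothesis th_le1 : w (j (theta iota)) <= 1.
Hypothesis tau_le1 : forall m m', w (j (taucoef u m m')) <= 1.
Local Notation q := #|F|.
Local Notation G := (Gsu iota s u).
Local Notation d := (Gdim s).
Local Notation jF := (j \o kconst iota).
Implicit Types z : 'cV[C]_d.

Lemma intpoly_kconst (b : {poly F}) : intpoly w (map_poly jF b).
Proof. by move=> i; rewrite coef_map abs_kconst_le1. Qed.

(* The values of a block are bounded because [b] is monic; if their maximum [M] exceeded 1, the
   structure equations would give [M^q <= M]. *)
Lemma orbit_integral (b : {poly F}) z : b \is monic ->
    (forall m k, w (orbit_seq iota u j (tapp j (G b) z) m k) <= 1) ->
  forall m k, w (orbit_seq iota u j z m k) <= 1.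
Proof.
move=> b_monic x_int; apply: descending_ind => m IH.
set f := orbit_seq iota u j z in IH *; pose D := (size b).-1.
have size_b : size b = D.+1 by rewrite prednK // size_poly_gt0 monic_neq0.
have [M [M1 HM M_attained]] := prefix_max (fun k => w (f m k)) D.
have M0 : 0 <= M := le_trans ler01 M1.
have fM k : w (f m k) <= M.
  have [e] := ubnP k; elim: e k => // e IHe k lt_k.
  have [/HM //|le_D] := ltnP k D.
  have -> : f m k = orbit_seq iota u j (tapp j (G b) z) m (k - D)
      - \sum_(i < D) (map_poly jF b)`_i * f m (k - D + i)%N.
    rewrite -orbit_act // (act_widen (n := D.+1)) ?size_map_poly ?size_b // big_ord_recr /=.
    by rewrite coef_map /= (monicP b_monic : b`_D = 1) !rmorph1 mul1r subnK // addrAC subrr add0r.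
  apply: absB_le; first exact: le_trans M1.
  apply: abs_sum_le => // i _; rewrite absM.
  have lt_i : (k - D + i < e)%N by have := ltn_ord i; lia.
  by rewrite (le_trans _ (IHe _ lt_i)) // ler_piMl ?abs_ge0 // intpoly_kconst.
case: M_attained => [M_eq1|[k0 M_k0]]; first by move=> k; rewrite -M_eq1.
suff : M ^+ q <= M.
  move=> le_M k; rewrite (le_trans (fM k)) // leNgt; apply/negP => gt1.
  by move: le_M; rewrite -[leRHS]expr1 ler_eXn2l // leqNgt (finNzRing_gt1 F).
rewrite M_k0 -absX -M_k0.
have -> : f m k0 ^+ q = act (('X - (j (theta iota))%:P) ^+ dsz s m) (f m) k0
    - \sum_(m' < r | (m <= m')%N && (m' != m)) j (taucoef u m m') * f m' k0 ^+ q.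
  by rewrite orbit_trisol // (bigD1 m) //= taucoef_diag rmorph1 mul1r addrK.
apply: absB_le; first by apply: act_abs_le => //; apply: intpoly_XsubC.
apply: abs_sum_le => // m' /andP[le_m ne_m]; rewrite (le_trans _ M1) // absM mulr_ile1 ?abs_ge0 //.
rewrite absX exprn_ile1 ?abs_ge0 // IH //.
by rewrite ltn_neqAle le_m andbT eq_sym.
Qed.

Lemma tapp_coord_lt z : (forall m k, w (orbit_seq iota u j z m k) < 1) -> mxabs w z < 1.
Proof.
move=> z_lt; apply/mxabs_ltP => // p c; rewrite [c]ord1.
have := orbit_coord iota u j z p 0%N; rewrite expr0 rmorph1 tapp1 => ->.
by apply: act_abs_lt => //; apply: intpoly_XsubC.
Qed.

End OrbitIntegral.

Section PowChar.
Context (A : comNzRingType) (n : nat).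

Definition powchar (_ : [pchar A].-nat n) (x : A) : A := x ^+ n.
Context (nA : [pchar A].-nat n).

Lemma powchar_zmod : zmod_morphism (powchar nA).
Proof. by move=> x y; rewrite /powchar exprDn_pchar // exprNn_pchar. Qed.

Lemma powchar_monoid : monoid_morphism (powchar nA).
Proof. by split=> [|x y]; rewrite /powchar ?expr1n ?exprMn. Qed.

HB.instance Definition _ := GRing.isZmodMorphism.Build A A (powchar nA) powchar_zmod.
HB.instance Definition _ := GRing.isMonoidMorphism.Build A A (powchar nA) powchar_monoid.

End PowChar.

Section ResidueRing.
Context (R : realType) (C : fieldType) (w : absval R C).
Local Notation O := (valring w).
Local Notation kappa := (residue_ring w).

Lemma residue_zmod : zmod_morphism (@residue R C w).
Proof. exact: rmorphB. Qed.

Lemma residue_monoid : monoid_morphism (@residue R C w).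
Proof. by split; [apply: rmorph1 | apply: rmorphM]. Qed.

HB.instance Definition _ := GRing.isZmodMorphism.Build O kappa (@residue R C w) residue_zmod.
HB.instance Definition _ := GRing.isMonoidMorphism.Build O kappa (@residue R C w) residue_monoid.

Lemma residue_eq0 (x : O) : (residue x == 0) = (w (val x) < 1).
Proof.
rewrite -[0](rmorph0 (@residue R C w)) /residue -(Quotient.idealrBE (@maxideal R C w)).
by rewrite subr0.
Qed.

Lemma residue_surj (y : kappa) : exists x, residue x = y.
Proof. by exists (repr y); rewrite /residue reprK. Qed.

(** Reducedness, inherited from the absolute value, makes the Frobenius of the residue ring
    injective. *)
Lemma residue_expr_inj n : (0 < n)%N -> forall y : kappa, y ^+ n = 0 -> y = 0.
Proof.
move=> n_gt0 y; have [x <-] := residue_surj y; rewrite -rmorphXn => /eqP.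
rewrite residue_eq0 rmorphXn absX => lt1; apply/eqP; rewrite residue_eq0 /=.
by move: lt1; rewrite expr_lt1 ?abs_ge0.
Qed.

(* In a subfield of [N] elements, multiplication by [y] permutes the nonzero elements. *)
Lemma subfield_card_expr (N : nat) (y : kappa) : in_subfield_card N y -> y ^+ N = y.
Proof.
move=> [S [S_uniq size_S [S1 SB SM] SV yS]].
have S0 : 0 \in S by rewrite -(subrr 1) SB.
have N_gt0 : (0 < N)%N by rewrite -size_S; case: (S) S0.
have [->|y0] := eqVneq y 0; first by rewrite expr0n gtn_eqF.
have [y' y'S yy'] := SV y yS y0.
pose S' := [seq a <- S | a != 0].
have size_S' : size S' = N.-1 by rewrite /S' -rem_filter // size_rem // size_S.
have [b Hb] : exists b, (\prod_(a <- S') a) * b = 1.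
  rewrite big_seq; elim/big_ind: _ => [|a a' [c ac] [c' ac']|a].
  - by exists 1; rewrite mulr1.
  - by exists (c * c'); rewrite mulrACA ac ac' mulr1.
  - by rewrite mem_filter => /andP[a0 aS]; have [c _ ac] := SV a aS a0; exists c.
have perm_S' : perm_eq [seq y * a | a <- S'] S'.
  have inj_y : injective ( *%R y).
    by move=> a a' e; rewrite -[a]mul1r -[a']mul1r -yy' [y * y']mulrC -!mulrA e.
  have map_uniq : uniq [seq y * a | a <- S'] by rewrite map_inj_uniq ?filter_uniq.
  have sub : {subset [seq y * a | a <- S'] <= S'}.
    move=> z /mapP[a]; rewrite !mem_filter => /andP[a0 aS] ->; rewrite SM // andbT.
    by apply: contraNneq a0 => ya0; apply/eqP/inj_y; rewrite ya0 mulr0.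
  have le_size : (size S' <= size [seq (y * a)%R | a <- S'])%N by rewrite size_map.
  have [_ e] := uniq_min_size map_uniq sub le_size.
  by apply: uniq_perm; rewrite ?filter_uniq.
suff : y ^+ N.-1 = 1 by move=> e; rewrite -(prednK N_gt0) exprS e mulr1.
have prodM l : \prod_(a <- l) (y * a) = y ^+ size l * \prod_(a <- l) a.
  elim: l => [|a l IH]; first by rewrite !big_nil mulr1.
  by rewrite !big_cons IH exprS mulrACA.
have := perm_big _ perm_S' : \prod_(a <- _) a = \prod_(a <- S') a.
rewrite big_map prodM size_S' => e.
by rewrite -[LHS]mulr1 -Hb mulrA e.
Qed.

End ResidueRing.

Section ConstantsIntegral.
Context (F : finFieldType) (K : closedFieldType) (iota : {rmorphism {fraction {poly F}} -> K}).
Context (R : realType) (C : fieldType) (w : absval R C) (j : {rmorphism K -> C}).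

Definition kint (c : F) : valring w := ValRing (abs_kconst_le1 iota w j c).

Lemma kint_zmod : zmod_morphism kint.
Proof. by move=> x y; apply: val_inj; rewrite /= !rmorphB. Qed.

Lemma kint_monoid : monoid_morphism kint.
Proof. by split=> [|x y]; apply: val_inj; rewrite /= ?rmorph1 // !rmorphM. Qed.

HB.instance Definition _ := GRing.isZmodMorphism.Build F (valring w) kint kint_zmod.
HB.instance Definition _ := GRing.isMonoidMorphism.Build F (valring w) kint kint_monoid.

Lemma pnat_residue_pchar : [pchar residue_ring w].-nat #|F|.
Proof.
apply: sub_in_pnat (pnat_card_pchar (j \o iota)) => p _; rewrite !inE => /andP[-> /eqP p0].
rewrite -(rmorph_nat (@residue R C w)) residue_eq0.
have -> : val (p%:R : valring w) = 0 by rewrite rmorph_nat.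
by rewrite abs0 ltr01.
Qed.

End ConstantsIntegral.

Section Reduction.
Context (F : finFieldType) (K : closedFieldType) (iota : {rmorphism {fraction {poly F}} -> K}).
Context (r : nat) (s : 'I_r -> nat) (u : 'I_r -> K).
Context (R : realType) (C : fieldType) (w : absval R C) (j : {rmorphism K -> C}).
Context (v : {poly F}) (v_monic : v \is monic) (v_irr : irreducible_poly v).
Hypothesis s_gt0 : forall i, (0 < s i)%N.
Hypothesis w_v : w (j (thetaev iota v)) < 1.
Local Notation q := #|F|.
Local Notation D := (size v).-1.
Local Notation G := (Gsu iota s u).
Local Notation d := (Gdim s).
Local Notation jF := (j \o kconst iota).
Local Notation O := (valring w).
Local Notation kappa := (residue_ring w).

Lemma Gtau_taucoef m m' : exists p p', Gtau s u p p' = taucoef u m m'.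
Proof.
have d_gt0 := dsz_gt0 m s_gt0; have d'_gt0 := dsz_gt0 m' s_gt0.
have [|p [p1 p2]] := @crd_ex _ s m (dsz s m).-1; first by rewrite prednK.
have [p' [p'1 p'2]] := crd_ex d'_gt0.
exists p, p'; rewrite !mxE p'2 p2 p1 p'1 prednK // !eqxx /taucoef.
by case: leqP.
Qed.

Context (l : nat).
Local Notation N := ((q ^ D) ^ l)%N.

(* The residue of [x] exists and lies in the subfield with [N] elements. *)
Definition nearfixed (x : C) := w x <= 1 /\ w (x ^+ N - x) < 1.

Lemma residue_in_nearfixed x : residue_in w j N x -> nearfixed (j x).
Proof.
move=> [x_int /subfield_card_expr]; rewrite -rmorphXn => e; split=> //.
have : residue (ValRing x_int ^+ N - ValRing x_int) == 0 by rewrite rmorphB e subrr.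
by rewrite residue_eq0 rmorphB rmorphXn.
Qed.

Lemma pnat_N : [pchar C].-nat N.
Proof. by rewrite -expnM pnatX (pnat_card_pchar (j \o iota)). Qed.

Lemma N_gt0 : (0 < N)%N.
Proof. by rewrite -expnM q_gt0. Qed.

Lemma nearfixed0 : nearfixed 0.
Proof. by split; rewrite ?expr0n ?gtn_eqF ?N_gt0 ?subrr ?abs0 ?ler01 ?ltr01. Qed.

Lemma nearfixedD x y : nearfixed x -> nearfixed y -> nearfixed (x + y).
Proof.
move=> [x1 xN] [y1 yN]; split; first exact: absD_le.
rewrite exprDn_pchar ?pnat_N // opprD addrACA; exact: absD_lt.
Qed.

Lemma nearfixedM x y : nearfixed x -> nearfixed y -> nearfixed (x * y).
Proof.
move=> [x1 xN] [y1 yN]; split; first by rewrite absM mulr_ile1 ?abs_ge0.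
have -> : (x * y) ^+ N - x * y = (x ^+ N - x) * y ^+ N + x * (y ^+ N - y).
  by rewrite exprMn mulrBl mulrBr addrA subrK.
apply: absD_lt; rewrite absM.
  by rewrite (le_lt_trans _ xN) // ler_piMr ?abs_ge0 // absX exprn_ile1 ?abs_ge0.
by rewrite (le_lt_trans _ yN) // ler_piMl ?abs_ge0.
Qed.

Lemma nearfixedX x n : nearfixed x -> nearfixed (x ^+ n).
Proof.
move=> fx; elim: n => [|n IH]; last by rewrite exprS; apply: nearfixedM.
by split; rewrite ?expr1n ?subrr ?abs0 ?abs1 ?ltr01 ?ler01.
Qed.

Lemma nearfixed_sum (I : Type) (t : seq I) (P : pred I) (h : I -> C) :
  (forall i, P i -> nearfixed (h i)) -> nearfixed (\sum_(i <- t | P i) h i).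
Proof.
move=> Hh; elim/big_ind: _ => [|x y fx fy|]; [exact: nearfixed0 | exact: nearfixedD | exact: Hh].
Qed.

Lemma nearfixed_tapp (P : 'M[skewpoly (frob iota)]_d) (z : 'cV[C]_d) :
    (forall i a b, nearfixed (j (tcoef P i a b))) -> (forall a, nearfixed (z a 0)) ->
  forall a, nearfixed (tapp j P z a 0).
Proof.
move=> P_fix z_fix a; rewrite mxE; apply: nearfixed_sum => b _; apply: nearfixed_sum => i _.
by apply: nearfixedM; [have := P_fix i a b; rewrite mxE | apply/nearfixedX].
Qed.

(** The residues of the orbit of [y] solve the triangular system with [phi] the q-th and [sg] the
    q^(D l)-th power map; [trisol_annihilated] makes the residues of [a]y vanish. *)
Lemma reduction_small n (y : 'cV[K]_d) :
    Gpoints G (residue_in w j N) (tapp idfun (G (v ^+ n)) y) ->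
    (forall m, dsz s m %| n)%N ->
  mxabs w (map_mx j (tapp idfun (G (\prod_(m < r) (v ^+ (dsz s m * l) - 1))) y)) < 1.
Proof.
move=> [G_fix x_fix] dvd_n; set a := \prod_(m < r) _.
pose z := map_mx j y; pose x := tapp j (G (v ^+ n)) z.
have {}x_fix p : nearfixed (x p 0).
  have := residue_in_nearfixed (x_fix p).
  have /(congr1 (fun y : 'cV[C]_d => y p 0)) := map_tapp idfun j (G (v ^+ n)) y.
  by rewrite mxE => ->.
have {}G_fix i p p' : nearfixed (j (tcoef (G 'X) i p p')) by apply: residue_in_nearfixed.
(* The N-th power fixes, modulo the maximal ideal, the coefficients of [t] and the point [v^n]y,
   hence its whole orbit. *)
have orbit_fix k p : nearfixed (tapp j (G ('X ^+ k)) x p 0).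
  elim: k p => [|k IH] p; first by rewrite expr0 rmorph1 tapp1.
  by rewrite tapp_XS; apply: nearfixed_tapp.
have x_seq_fix m k : nearfixed (orbit_seq iota u j x m k) by apply: nearfixed_sum.
have tau_fix m m' : nearfixed (j (taucoef u m m')).
  by have [p [p' <-]] := Gtau_taucoef m m'; have := G_fix 1%N p p'; rewrite tcoef_Gsu.
have th_le1 := abs_theta_le1 v_monic w_v.
have tau_le1 m m' : w (j (taucoef u m m')) <= 1 by have [] := tau_fix m m'.
(* Integrality is known for [v^n]y and must pass to [y] before residues can be taken. *)
have f_int m k : w (orbit_seq iota u j z m k) <= 1.
  move: m k; apply: (orbit_integral s_gt0 th_le1 tau_le1 (monic_exp n v_monic)).
  by move=> m' k'; have [] := x_seq_fix m' k'.
have -> : map_mx j (tapp idfun (G a) y) = tapp j (G a) z by rewrite map_tapp.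
apply: (tapp_coord_lt (u := u) th_le1) => m k; rewrite -orbit_act //.
pose thO : O := ValRing th_le1.
pose cO m m' : O := ValRing (tau_le1 m m').
pose fO m k : O := ValRing (f_int m k).
pose vO := map_poly (kint iota w j) v.
have mapO b : map_poly val (map_poly (kint iota w j) b) = map_poly jF b :> {poly C}.
  by apply/polyP => i; rewrite !coef_map.
have fOE m' : val \o fO m' = orbit_seq iota u j z m' by [].
have solO m' k' : act (('X - thO%:P) ^+ dsz s m') (fO m') k'
    = \sum_(i < r | (m' <= i)%N) cO m' i * fO i k' ^+ q.
  apply: val_inj; rewrite act_map map_polyXsubC_exp fOE orbit_trisol //.
  by rewrite rmorph_sum; apply: eq_bigr => i _; rewrite rmorphM rmorphXn.
have qk := pnat_residue_pchar iota w j.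
have Nk : [pchar kappa].-nat (q ^ (D * l))%N by rewrite pnatX qk.
pose phi : {rmorphism kappa -> kappa} := powchar qk.
pose sg : {rmorphism kappa -> kappa} := powchar Nk.
have iter_phi i t : iter i phi t = t ^+ (q ^ i).
  by elim: i => [|i IH]; rewrite ?expr1 // iterS IH /= /powchar -exprM expnSr.
pose res : {rmorphism O -> kappa} := @residue R C w.
pose V := map_poly res vO.
have V_phi : map_poly phi V = V.
  apply/polyP => i; rewrite !coef_map /= /powchar -!rmorphXn; congr (res (kint _ _ _ _)).
  exact: expf_card.
(* [v] splits over the Frobenius orbit of [al], and theta has the same residue as [al]. *)
have [al [al_root al_le1 th_al]] := near_root v_monic w_v.
pose alO : O := ValRing al_le1.
have th_alO : res thO = res alO.
  apply/eqP; rewrite -subr_eq0 -rmorphB residue_eq0 /=.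
  by move: th_al; rewrite rmorphB.
have V_prod : V = \prod_(i < D) ('X - (iter i phi (res thO))%:P).
  rewrite /V; have -> : vO = \prod_(i < D) ('X - (alO ^+ (q ^ i))%:P).
    apply: (map_inj_poly val_inj (rmorph0 _)); rewrite mapO rmorph_prod.
    have -> : map_poly jF v = map_poly j (map_poly (kconst iota) v).
      by apply/polyP => i; rewrite !coef_map.
    rewrite (kv_prod v_monic v_irr al_root) rmorph_prod; apply: eq_bigr => i _.
    apply: etrans (map_polyXsubC j _) _; apply: etrans _ (esym (map_polyXsubC _ _)).
    by rewrite !rmorphXn.
  rewrite rmorph_prod; apply: eq_bigr => i _.
  by apply: etrans (map_polyXsubC _ _) _; rewrite iter_phi th_alO rmorphXn.
have th_period : iter D phi (res thO) = res thO.
  rewrite iter_phi th_alO -rmorphXn; congr (res _); apply: val_inj.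
  by rewrite rmorphXn /= -rmorphXn (frob_period v_monic v_irr al_root).
have q0 i : (0 < q ^ i)%N by apply: q_gt0.
have phi_inj : injective phi.
  move=> t t' e; apply/eqP; rewrite -subr_eq0; apply/eqP.
  apply: (residue_expr_inj (q0 1%N)); rewrite expn1 -[LHS]/(phi _) rmorphB e; exact: subrr.
have sg_fix t (t_fix : nearfixed (val t)) : sg (res t) = res t.
  apply/eqP; rewrite -subr_eq0 /= /powchar -rmorphXn -rmorphB residue_eq0.
  by rewrite rmorphB rmorphXn /= expnM; have [] := t_fix.
pose ck m' m'' := res (cO m' m''); pose fk m' k' := res (fO m' k').
have ck_diag m' : ck m' m' = 1.
  by rewrite -(rmorph1 res); congr (res _); apply: val_inj; rewrite /= taucoef_diag rmorph1.
have sg_iter t : sg t = iter (D * l) phi t by rewrite iter_phi.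
have sg_ck m' m'' : sg (ck m' m'') = ck m' m'' by apply/sg_fix/tau_fix.
have sol_fk : trisol phi (dsz s) (res thO) ck fk.
  move=> m' k'; have := congr1 res (solO m' k').
  rewrite act_map map_polyXsubC_exp => ->.
  by rewrite rmorph_sum; apply: eq_bigr => i _; rewrite rmorphM rmorphXn.
(* [V ^+ n] carries the orbit of [y] to that of [v^n]y, whose residues are fixed. *)
have sg_Vfk m' k' : sg (act (V ^+ n) (fk m') k') = act (V ^+ n) (fk m') k'.
  have -> : V ^+ n = map_poly res (map_poly (kint iota w j) (v ^+ n)) by rewrite !rmorphXn.
  by rewrite -(act_map res); apply: sg_fix; rewrite act_map mapO fOE orbit_act.
have ann := trisol_annihilated ck_diag phi_inj V_phi V_prod th_period sg_iter sg_ck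
  dvd_n sol_fk sg_Vfk m k.
have : res (act (map_poly (kint iota w j) a) (fO m) k) = 0.
  rewrite act_map -[RHS]ann; congr (act _ _ _).
  by rewrite !rmorph_prod; apply: eq_bigr => i _; rewrite !rmorphB !rmorph1 !rmorphXn.
move=> /eqP; rewrite residue_eq0 act_map mapO fOE.
exact.
Qed.

End Reduction.

(** * Division by powers of [v] *)

Section DpartInverse.
Context (F : finFieldType) (K : fieldType) (iota : {rmorphism {fraction {poly F}} -> K}).
Context (d : nat) (G : tmodule iota d).
Context (R : realType) (C : fieldType) (w : absval R C) (j : {rmorphism K -> C}).

Lemma unitmx_pow_scalar (A : 'M[C]_d) n c : (0 < n)%N -> c != 0 -> A ^+ n = c%:M ->
  A \in unitmx.
Proof.
case: n => // n _ c0 An; suff /mulmx1_unit[] : A *m (c^-1 *: A ^+ n) = 1%:M by [].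
by rewrite -scalemxAr -[_ *m _]/(A * _) -exprS An scale_scalar_mx mulVf.
Qed.

Lemma map_dpart_pow : exists2 n, (0 < n)%N & forall a,
  map_mx j (dpart (G a)) ^+ n = (j (thetaev iota a) ^+ n)%:M.
Proof.
have [e He] := dpart_pow G; exists (#|F| ^ e)%N; first exact: q_gt0.
have map_pow (A : 'M[K]_d) n : map_mx j (A ^+ n) = map_mx j A ^+ n.
  elim: n => [|n IH]; first by rewrite !expr0 map_mx1.
  by rewrite !exprS -IH; apply: map_mxM.
by move=> a; rewrite -map_pow He map_scalar_mx rmorphXn.
Qed.

Lemma map_dpart_unit a : a != 0 -> map_mx j (dpart (G a)) \in unitmx.
Proof.
move=> a0; have [n n_gt0 Hn] := map_dpart_pow.
by apply: unitmx_pow_scalar (Hn a); rewrite // expf_eq0 n_gt0 /= fmorph_eq0 thetaev_eq0.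
Qed.

Lemma map_dpartX a n : map_mx j (dpart (G (a ^+ n))) = map_mx j (dpart (G a)) ^+ n.
Proof.
elim: n => [|n IH]; last by rewrite !exprS rmorphM dpartM map_mxM IH.
have dpart1 : dpart (G 1) = 1%:M.
  by rewrite rmorph1 -(Fscal1 iota) /dpart tcoef_Fscal /= rmorph1.
by rewrite !expr0 dpart1 map_mx1.
Qed.

(* Some power of [∂[a]] is the scalar matrix of a power of [a(theta)], so the sequence is
   multiplied by a fixed factor of absolute value [< 1] over each period. *)
Lemma dpart_inv_null a (z : 'cV[C]_d) : 1 < w (j (thetaev iota a)) ->
  null_seq (fun n => mxabs w (invmx (map_mx j (dpart (G (a ^+ n)))) *m z)).
Proof.
move=> a_gt1; have [M M_gt0 HM] := map_dpart_pow.
pose be := j (thetaev iota a) ^+ M; pose x := w be^-1.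
have a0 : j (thetaev iota a) != 0 by rewrite -(abs_eq0 w) gt_eqF // (lt_trans ltr01).
have be0 : be != 0 by rewrite expf_neq0.
have be_gt1 : 1 < w be by rewrite absX exprn_egt1 // -lt0n.
have x_bounds : 0 <= x < 1 by rewrite abs_ge0 /x absV invf_lt1 ?(lt_trans ltr01).
have [x0 x1] := andP x_bounds.
pose Z n := invmx (map_mx j (dpart (G (a ^+ n)))) *m z; rewrite -/(Z _).
have Z_shift n : mxabs w (Z (n + M)%N) = x * mxabs w (Z n).
  rewrite -mxabsZ; congr (mxabs w _); rewrite /Z !map_dpartX exprD HM -/be.
  rewrite -[_ * be%:M]/(_ *m _) mul_mx_scalar invmxZ ?scalemxAl //.
  rewrite unitmxZ ?unitfE // -map_dpartX map_dpart_unit // expf_neq0 //.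
  by apply: contraNneq a0 => ->; rewrite !rmorph0.
have Z_mult k n : mxabs w (Z (n + k * M)%N) = x ^+ k * mxabs w (Z n).
  elim: k => [|k IH]; first by rewrite addn0 mul1r.
  by rewrite mulSn [(M + _)%N]addnC addnA Z_shift IH mulrA -exprS.
pose B := \sum_(i < M) mxabs w (Z i).
have B0 : 0 <= B by apply: sumr_ge0 => i _; apply: mxabs_ge0.
have Z_le n : mxabs w (Z n) <= B * x ^+ (n %/ M).
  rewrite {1}(divn_eq n M) addnC Z_mult mulrC ler_wpM2r ?exprn_ge0 //.
  rewrite /B (bigD1 (Ordinal (ltn_pmod n M_gt0))) //= lerDl.
  by apply: sumr_ge0 => i _; apply: mxabs_ge0.
move=> e e0; have geo : null_seq (fun k => B * x ^+ k) by apply/null_seqZ/null_seq_geo.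
have [k Hk] := geo e e0; exists (k * M)%N => n le_n.
by apply: le_lt_trans (Z_le n) _; apply: Hk; rewrite leq_divRL.
Qed.

End DpartInverse.

Lemma abs_thetaev_gt1 (F : finFieldType) (K : closedFieldType)
    (iota : {rmorphism {fraction {poly F}} -> K}) (R : realType) (C : fieldType)
    (w : absval R C) (j : {rmorphism K -> C}) (v : {poly F}) :
  1 < w (j (theta iota)) -> v \is monic -> (1 < size v)%N -> 1 < w (j (thetaev iota v)).
Proof.
move=> th_gt1 v_monic; case size_v: (size v) => [|[|n]] // _.
have th_ge0 : 0 <= w (j (theta iota)) by apply: abs_ge0.
rewrite thetaevE horner_coef size_map_poly size_v big_ord_recr /= coef_map /=.
have -> : v`_n.+1 = 1 by have := monicP v_monic; rewrite lead_coefE size_v.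
rewrite rmorph1 mul1r rmorphD addrC rmorphXn absD_dominant absX ?exprn_egt1 //.
apply: (@le_lt_trans _ _ (w (j (theta iota)) ^+ n)); last by rewrite ltr_eXn2l.
rewrite rmorph_sum; apply: abs_sum_le => [|i _]; first exact: exprn_ge0.
rewrite rmorphM absM rmorphXn absX coef_map /=.
rewrite (le_trans (ler_wpM2r (exprn_ge0 _ th_ge0) (abs_kconst_le1 iota w j _))) //.
by rewrite mul1r ler_weXn2l ?(ltW th_gt1) // -ltnS.
Qed.

Theorem theorem3p1
  (R : realType) (F : finFieldType)
  (kbar : closedFieldType) (iota : {rmorphism {fraction {poly F}} -> kbar})
  (kbar_alg : forall x, algebraicOver iota x)
  (Cinf : fieldType) (winf : absval R Cinf) (jinf : {rmorphism kbar -> Cinf})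
  (Cinf_def : completed_algclosure winf (jinf \o iota))
  (winf_theta : winf (jinf (theta iota)) = #|F|%:R)
  (v : {poly F}) (v_monic : v \is monic) (v_irr : irreducible_poly v)
  (Cv : fieldType) (wv : absval R Cv) (jv : {rmorphism kbar -> Cv})
  (Cv_def : completed_algclosure wv (jv \o iota))
  (wv_v : wv (jv (iota (FracField.tofrac v))) = (#|F| ^ (size v).-1)%:R^-1)
  (r : nat) (r_gt0 : (0 < r)%N)
  (s : 'I_r -> nat) (s_gt0 : forall i, (0 < s i)%N)
  (u : 'I_r -> kbar)
  (u_dom : DDef winf jinf wv jv #|F| (s \o @rev_ord r) (u \o @rev_ord r)) :
  let G := Gsu iota s u in
  let expG (z : 'cV[Cinf]_(Gdim s)) := qeval winf #|F| jinf (exp_series G) z in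
  let logG (z : 'cV[Cinf]_(Gdim s)) := qeval winf #|F| jinf (log_series G) z in
  let log_cvg (z : 'cV[Cinf]_(Gdim s)) := qcvg winf #|F| jinf (log_series G) z in
  let logv_cvg (z : 'cV[Cv]_(Gdim s)) := qcvg wv #|F| jv (log_series G) z in
  forall (x : 'cV[kbar]_(Gdim s))
    (x_int : Gpoints G (integral_at wv jv) x)
    (x_log : log_cvg (map_mx jinf x))
    (l : nat) (l_gt0 : (0 < l)%N)
    (x_l : Gpoints G (residue_in wv jv ((#|F| ^ (size v).-1) ^ l)) x)
    (D : set 'cV[Cinf]_(Gdim s)) (D_def : isometry_nbhs0 winf expG D),
  let a : {poly F} := \prod_(m < r) (v ^+ (dsz s m * l) - 1) in
  let Z n := invmx (map_mx jinf (dpart (G (v ^+ n)))) *m logG (map_mx jinf x) in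
  let vv n := expG (Z n) in
  [/\ (forall n, tapp jinf (G (v ^+ n)) (vv n) = map_mx jinf x /\
        exists y : 'cV[kbar]_(Gdim s), map_mx jinf y = vv n),
      (forall n (y : 'cV[kbar]_(Gdim s)), map_mx jinf y = vv n ->
        (\big[lcmn/1%N]_(m < r) dsz s m %| n)%N ->
        mxabs wv (map_mx jv (tapp idfun (G a) y)) < 1 /\
        logv_cvg (map_mx jv (tapp idfun (G a) y)))
    & [/\ (fun n => mxabs winf (Z n)) @ \oo --> (0 : R),
        (\forall n \near \oo,
          [/\ log_cvg (tapp jinf (G a) (vv n)), log_cvg (vv n),
              D (logG (tapp jinf (G a) (vv n))),
              D (map_mx jinf (dpart (G a)) *m logG (vv n))
            & D (Z n)])
      & [/\ exists L, mxlim winf (fun n => logG (tapp jinf (G a) (vv n))) L,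
          exists L, mxlim winf (fun n => map_mx jinf (dpart (G a)) *m logG (vv n)) L
        & exists L, mxlim winf Z L]]].
Proof.
move=> G expG logG log_cvg logv_cvg x x_int x_log l l_gt0 x_l D D_def a Z vv.
have [complete_inf _ _] := Cinf_def; have [complete_v _ _] := Cv_def.
have v0 : v != 0 by apply: monic_neq0.
have v_gt1 : 1 < winf (jinf (thetaev iota v)).
  apply: abs_thetaev_gt1 v_monic v_irr.1; rewrite winf_theta ltr1n; exact: q_gt1.
have w_v : wv (jv (thetaev iota v)) < 1.
  rewrite /thetaev wv_v invf_lt1 ?ltr0n ?ltr1n ?q_gt0 //.
  by rewrite -{1}(expn0 #|F|) ltn_exp2l ?q_gt1 // -ltnS prednK ?v_irr.1 // size_poly_gt0.
have dZ n : map_mx jinf (dpart (G (v ^+ n))) *m Z n = logG (map_mx jinf x).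
  by rewrite /Z mulmxA mulmxV ?mul1mx // map_dpart_unit // expf_neq0.
have vvE n : tapp jinf (G (v ^+ n)) (vv n) = map_mx jinf x.
  by rewrite /vv exp_dpart // dZ exp_log.
have Z0 : null_seq (fun n => mxabs winf (Z n)) by apply: dpart_inv_null.
pose da := map_mx jinf (dpart (G a)).
have dZ0 : null_seq (fun n => mxabs winf (da *m Z n)).
  by apply: (null_seq_le (N := 0)) (null_seqZ (mxabs_ge0 winf da) Z0) => n _; apply: mxabsM.
have avvE n : tapp jinf (G a) (vv n) = expG (da *m Z n) by rewrite /vv exp_dpart.
have [[e e0 De] _] := D_def.
(* For large n, both Z_n and ∂[a]Z_n lie in the ball of [log_exp] and in the e-ball inside [D]. *)
pose g := tau_bound s u winf jinf ^+ 3.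
have g0 : 0 <= g by rewrite exprn_ge0 // tau_bound_ge0.
have [N HN] : exists N, forall n, (N <= n)%N ->
    [/\ log_cvg (vv n) /\ logG (vv n) = Z n,
        log_cvg (tapp jinf (G a) (vv n)) /\ logG (tapp jinf (G a) (vv n)) = da *m Z n,
        D (Z n) & D (da *m Z n)].
  have [N1 H1] := null_seqZ g0 Z0 ltr01; have [N2 H2] := null_seqZ g0 dZ0 ltr01.
  have [N3 H3] := Z0 e e0; have [N4 H4] := dZ0 e e0.
  exists (N1 + N2 + N3 + N4)%N => n le_n; split.
  - by apply: log_exp => //; apply: H1; lia.
  - by rewrite avvE; apply: log_exp => //; apply: H2; lia.
  - by apply/De/H3; lia.
  - by apply/De/H4; lia.
split=> [n|n y yE dvd_n|].
- split=> //; apply: (tapp_algebraic s_gt0 (monic_exp n v_monic) (vvE n)).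
(* The relation in C_inf descends to [kbar] by injectivity of [jinf] and can then be read in C_v. *)
- have yx : tapp idfun (G (v ^+ n)) y = x.
    by apply: (@map_mx_inj _ _ jinf); rewrite map_tapp -(vvE n) -yE.
  have small : mxabs wv (map_mx jv (tapp idfun (G a) y)) < 1.
    apply: (reduction_small v_monic v_irr s_gt0 w_v (n := n)); first by rewrite yx.
    by move=> m; apply: dvdn_trans dvd_n; apply: (biglcmn_sup m).
  (* |v(theta)| serves as the lower bound for all |theta^(q^n) - theta| in [log_cvg_small]. *)
  split=> //; have c_pos : 0 < wv (jv (thetaev iota v)).
    by rewrite lt_neqAle abs_ge0 andbT eq_sym abs_eq0 fmorph_eq0 thetaev_eq0.
  have tau_le1 : mxabs wv (map_mx jv (Gtau s u)) <= 1.
    have <- : tcoef (G 'X) 1 = Gtau s u by rewrite tcoef_Gsu.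
    by apply/mxabs_leP => // p p'; rewrite mxE; apply: x_int.1.
  have c_bounds : 0 < wv (jv (thetaev iota v)) <= 1 by rewrite c_pos ltW.
  apply: (log_cvg_small complete_v tau_le1 c_bounds _ small) => n'.
  exact: abs_thetadiff_ge.
split; first by apply/null_seqP => // n; apply: mxabs_ge0.
  exists N => // n /= /HN[[cv1 ->] [cv2 ->] DZ DdZ]; by split.
split; exists 0; apply/mxlimP.
- apply: (null_seq_le (N := N)) dZ0 => n /HN[_ [_ ->] _ _].
  by rewrite subr0.
- apply: (null_seq_le (N := N)) dZ0 => n /HN[[_ ->] _ _ _].
  by rewrite subr0.
- by apply: (null_seq_le (N := 0)) Z0 => n _; rewrite subr0.
Qed.
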